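(* There exist constants $c_1,c_2\in(0,\infty)$, depending only on $d$, $\Gamma$ and $c_0$, such that the following holds. Let $S,S'\subset\mathbb Z^d$ be non-empty, finite and disjoint, let $\varepsilon>0$, and let $(\Lambda_n)_{n\ge0}$ be any increasing sequence of finite subsets of $\mathbb Z^d$ with union $\mathbb Z^d$. For any sequence $(M_n)_{n\ge0}$ with $M_n>0$ for all $n$, denoting $M_\infty=\limsup_nM_n$ and $$\sigma^*=\sup_{x\in S}\frac{\sup_{y\in S'}g^*(x,y)}{\inf_{y\in S'}g^*(x,y)},$$ one has $$\liminf_{n\to\infty}Q^0_{\Lambda_n}[G^c_{\Lambda_n,M_n}]\le c_1|S|\,2^{|\partial_{\mathrm i}S'|}\exp\Big\{-c_2\Big(\frac{\mathrm{cap}^*(S')\,M_\infty}{(\sigma^* )^2\,|\partial_{\mathrm i}S'|}\Big)^2\Big\}.$$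
   Context: **Graph.** Let $d\ge3$ and let $\Gamma\subset\mathbb Z^d$ be finite with $0\notin\Gamma$, $\Gamma=-\Gamma$, such that every $x\in\mathbb Z^d$ is a finite sum of elements of $\Gamma$. Let $\mathscr E=\{(x,x+y):x\in\mathbb Z^d,y\in\Gamma\}$ (oriented edges; $x\sim y$ means $(x,y)\in\mathscr E$), $\mathcal G=(\mathbb Z^d,\mathscr E)$, $B(x,L)$ the ball of radius $L$ around $x$ in the graph distance of $\mathcal G$. For $e=(x,y)\in\mathscr E$ write $x(e)=x$. For $\Lambda\subset\mathbb Z^d$: $\Lambda^c=\mathbb Z^d\setminus\Lambda$, $\partial\Lambda=\{z\in\Lambda^c:\exists x\in\Lambda,(x,z)\in\mathscr E\}$, $\overline\Lambda=\Lambda\cup\partial\Lambda$, $\partial_{\mathrm i}\Lambda=\partial(\Lambda^c)$; $\mathscr E_\Lambda$ is the set of edges with at least one endpoint in $\Lambda$ and $\mathcal G_\Lambda=(\overline\Lambda,\mathscr E_\Lambda)$. **Gibbs measures.** $\Omega=\mathbb R^{\mathbb Z^d}$ with coordinates $\varphi_x$; $\Omega_\Lambda=\mathbb R^\Lambda$; $\nabla\varphi(e)=\varphi_y-\varphi_x$ for $e=(x,y)$. Let $\mathcal B=\{B(x,1):x\in\mathbb Z^d\}$ and for $X=B(x,1)$ let $\mathscr E(X)=\{e\in\mathscr E:x(e)=x\}$. Fix a family of potentials $V_X:\mathbb R^{\mathscr E(X)}\to\mathbb R_+$, $X\in\mathcal B$, satisfying, for some $c_0\in[1,\infty)$ and $\alpha>0$: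 (smoothness) $V_X\in C^{2,\alpha}$ (twice continuously differentiable with $\alpha$-Hölder second derivatives); (symmetry) $V_X(\eta)=V_X(-\eta)$; (translation invariance) $V_{X+a}((\nabla\varphi(e))_{e\in\mathscr E(X+a)})=V_X((\nabla\varphi(e+a))_{e\in\mathscr E(X)})$ for $a\in\mathbb Z^d$, where $e+a=(x+a,y+a)$ for $e=(x,y)$; (uniform convexity) with $\partial^2_{x,y}=\partial^2/\partial\varphi_x\partial\varphi_y$, $c_0^{-1}\le-\sum_{X\in\mathcal B:X\supset\{x,y\}}\partial^2_{x,y}V_X((\nabla\varphi(e))_{e\in\mathscr E(X)})\le c_0$ for $(x,y)\in\mathscr E$, and $\partial^2_{x,y}V_X((\nabla\varphi(e))_{e\in\mathscr E(X)})=0$ for $x\ne y$ with $(x,y)\notin\mathscr E$. For finite $\Lambda$ let $H_\Lambda(\varphi)=\sum_{X\in\mathcal B:X\cap\Lambda\neq\emptyset}V_X((\nabla\varphi(e))_{e\in\mathscr E(X)})$; for a boundary condition $\xi$ (values on $\Lambda^c$), $H^\xi_\Lambda:\Omega_\Lambda\to\mathbb R$ is $H_\Lambda$ with $\varphi=\xi$ on $\Lambda^c$, and $\mu_\Lambda^\xi(d\varphi)=\frac1{Z_\Lambda^\xi}e^{-H_\Lambda^\xi(\varphi)}\prod_{x\in\Lambda}d\varphi_x$ is a probability measure on $\Omega_\Lambda$, identified with the measure on $\Omega$ under which $\varphi=\xi$ on $\Lambda^c$. $Q^0_\Lambda=\mu^0_\Lambda\otimes\mu^0_\Lambda$, the law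 on $\Omega\times\Omega$ of $\omega=(\varphi,\widetilde\varphi)$, two independent copies of the field under $\mu^0_\Lambda$. **Random walk.** For $(x,y)\in\mathscr E_\Lambda$, let $a^\xi_{x,y}(\varphi)=-\partial^2_{x,y}H_\Lambda(\varphi)$ evaluated with $\varphi=\xi$ on $\Lambda^c$, and $\Omega_\Lambda^\xi=\{\varphi\in\Omega:\varphi=\xi\text{ on }\Lambda^c\}$. For $x\in\Lambda$, $\varphi\in\Omega_\Lambda^\xi$, $\mathbf P^{\mathcal G_\Lambda,\xi}_{x,\varphi}$ (expectation $\mathbf E^{\mathcal G_\Lambda,\xi}_{x,\varphi}$) is the law of $(X_t,\Phi_t)_{t\ge0}$, where $\Phi$ solves $d\Phi_t(z)=-\frac{\partial H^\xi_\Lambda}{\partial\varphi_z}(\Phi_t)dt+\sqrt2\,dB_t(z)$ for $z\in\Lambda$ (independent Brownian motions $B(z)$), $\Phi_t=\xi$ on $\Lambda^c$, $\Phi_0=\varphi$, and, given $\Phi$, $X$ is the jump process on $\overline\Lambda$ started at $x$ which at time $t$ jumps from $z\in\Lambda$ to $y\sim z$ at rate $a^\xi_{z,y}(\Phi_t)$ and is stopped when it exits $\Lambda$. $\tau_K=\inf\{t>0:X_t\notin K\}$. **The event.** For finite $\Lambda\supset S\cup S'$, $\Lambda'=\Lambda\setminus S'$, $t\in[0,1]$, define the boundary condition on $(\Lambda')^c=\Lambda^c\cup S'$ by $\xi^\omega_x(t)=t\varepsilon$ for $x\in\Lambda^c$ and $\xi_x^\omega(t)=(1-t)\varphi_x+t(\widetilde\varphi_x+\varepsilon)$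 for $x\in S'$. For $M>0$, $$G^c_{\Lambda,M}=\bigcup_{t\in\mathbb Q\cap[0,1]}\ \bigcup_{(x,\varphi')\in S\times\mathbb Q^{\Lambda'}}\Big\{\omega:\ \mathbf E^{\mathcal G_{\Lambda'},\xi^\omega(t)}_{x,\varphi'}\big[\varphi_{X_{\tau_{\Lambda'}}}-\widetilde\varphi_{X_{\tau_{\Lambda'}}}\,\big|\,X_{\tau_{\Lambda'}}\in\partial_{\mathrm i}S'\big]>M\Big\},$$ where $\varphi'$ is extended by $\xi^\omega(t)$ outside $\Lambda'$ and $(\varphi,\widetilde\varphi)=\omega$ is fixed under the expectation. ($G^c_{\Lambda_n,M_n}$ is considered for $n$ large enough that $S\cup S'\subset\Lambda_n$.) **Simple random walk.** $P^*_x$ is the law of continuous-time simple random walk $(Z_t)$ on $\mathcal G$ started at $x$ with i.i.d. exponential holding times of parameter 1; $g^*(x,y)=E_x^*[\int_0^\infty1\{Z_t=y\}dt]$. For finite $U$, $e^*_U(y)=P^*_y[\widetilde H_U=\infty]1_{y\in U}$ with $\widetilde H_U=\inf\{t>0:Z_t\in U\text{ and }\exists s\in(0,t),Z_s\ne Z_0\}$, and $\mathrm{cap}^*(U)=\sum_{y\in U}e_U^*(y)$. *)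

(* Defs.v *)
From HB Require Import structures.
From mathcomp Require Import all_boot all_order all_algebra finmap.
From mathcomp Require Import all_classical all_reals all_analysis.
From mathcomp Require Import measurable_realfun.

Set Implicit Arguments.
Unset Strict Implicit.
Unset Printing Implicit Defensive.

Import Order.TTheory GRing.Theory Num.Theory.
Import numFieldNormedType.Exports.

Local Open Scope classical_set_scope.
Local Open Scope ring_scope.

Notation site d := 'rV[int]_d.

Section Graph.
Variables (d : nat) (Gam : {fset site d}).

Definition admissible_steps : Prop :=
  [/\ 0 \notin Gam,
      forall y, (y \in Gam) = (- y \in Gam) &
      forall x : site d,
        exists s : seq (site d), all (mem Gam) s /\ x = \sum_(y <- s) y].

Definition adj : rel (site d) := fun x y => y - x \in Gam.

Definition gball (x : site d) (L : nat) : set (site d) :=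
  [set z | exists s : seq (site d),
     [/\ path adj x s, last x s = z & (size s <= L)%N]].

Definition boundary (A : set (site d)) : set (site d) :=
  [set z | ~ A z /\ exists2 x, A x & adj x z].

Definition inner_boundary (A : set (site d)) : set (site d) := boundary (~` A).

Definition card_inner_boundary (A : {fset site d}) : nat :=
  #|` fset_set (inner_boundary [set` A])|.

Lemma gball1P x z : gball x 1 z <-> z = x \/ adj x z.
Proof.
split=> [[[|y [|? ?]] [//= p <- _]]|[->|xz]].
- by left.
- by right; move: p; rewrite andbT.
- by exists [::].
- by exists [:: z]; split => //=; rewrite xz.
Qed.

Lemma finite_touching (Lam : {fset site d}) :
  finite_set [set x | gball x 1 `&` [set` Lam] !=set0].
Proof.
pose A : {fset site d} :=
  (Lam `|` [fset (p : site d * site d).1 - p.2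
             | p in [seq (a, b) | a <- Lam, b <- Gam]])%fset.
apply: (@sub_finite_set _ _ [set` A]); last exact: finite_fset.
move=> x /= [z [/gball1P[->|xz] /= zL]]; rewrite !inE ?zL//.
apply/orP; right; apply/imfsetP; exists (z, z - x); last first.
  by rewrite /= opprB addrCA subrr addr0.
by apply/allpairsP; exists (z, z - x).
Qed.

End Graph.

Definition field_display : measure_display.
Proof. exact: default_measure_display. Qed.

(* The configuration space R^(Z^d), with its product sigma-algebra. *)
Definition field (R : realType) (d : nat) : Type := site d -> R.

HB.instance Definition _ (R : realType) d := Pointed.on (field R d).

Section FieldMeasurable.
Variables (R : realType) (d : nat).

Definition cylinders : set (set (field R d)) :=
  [set C | exists x : site d, exists2 A : set R,
     measurable A & C = (fun phi : field R d => phi x) @^-1` A].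

HB.instance Definition _ := @isMeasurable.Build field_display (field R d)
  (<<s cylinders >>) (@sigma_algebra0 _ setT cylinders)
  (@sigma_algebraC _ cylinders) (@sigma_algebra_bigcup _ setT cylinders).

Lemma measurable_coord (x : site d) :
  measurable_fun setT (fun phi : field R d => phi x).
Proof. by move=> _ A mA; rewrite setTI; apply: sub_gen_smallest; exists x, A. Qed.

Lemma measurable_to_field d' (T : measurableType d') (f : T -> field R d) :
  (forall x, measurable_fun setT (fun w => f w x)) -> measurable_fun setT f.
Proof.
move=> mf; apply: (@measurability _ _ _ _ _ _ cylinders) => //.
by move=> _ [_ [x [A mA ->]] <-]; exact: mf.
Qed.

Definition update (x : site d) (p : field R d * R) : field R d :=
  fun z => if z == x then p.2 else p.1 z.

Lemma measurable_update x : measurable_fun setT (update x).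
Proof.
apply: measurable_to_field => z; rewrite /update.
case: (z == x) => /=; first exact: measurable_snd.
exact: (measurableT_comp (measurable_coord z) measurable_fst).
Qed.

End FieldMeasurable.

Section Lebesgue.
Variables (R : realType) (d : nat).
Local Notation field := (field R d).

Definition lebesgue_add (m : {measure set field -> \bar R}) (x : site d) :
    set field -> \bar R :=
  pushforward (m \x @lebesgue_measure R)%E (update x).

Section lebesgue_add_measure.
Variables (m : {measure set field -> \bar R}) (x : site d).
Let mpre (A : set field) : measurable A -> measurable (@update R d x @^-1` A).
Proof. by move=> mA; rewrite -[X in measurable X]setTI; exact: measurable_update. Qed.
Let la0 : lebesgue_add m x set0 = 0%E.
Proof. by rewrite /lebesgue_add /pushforward preimage_set0 measure0. Qed.
Let la_ge0 A : (0 <= lebesgue_add m x A)%E.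
Proof. by rewrite /lebesgue_add /pushforward; exact: measure_ge0. Qed.
Let la_sigma : semi_sigma_additive (lebesgue_add m x).
Proof.
move=> F mF tF mUF; rewrite /lebesgue_add /pushforward preimage_bigcup.
apply: measure_semi_sigma_additive.
- by move=> n; exact: mpre.
- apply/trivIsetP => /= i j _ _ ij; rewrite -preimage_setI.
  by move/trivIsetP : tF => /(_ _ _ _ _ ij) ->//; rewrite preimage_set0.
- by rewrite -preimage_bigcup; exact: mpre.
Qed.
HB.instance Definition _ := isMeasure.Build _ _ _ (lebesgue_add m x)
  la0 la_ge0 la_sigma.
End lebesgue_add_measure.

Fixpoint lebesgue_seq (xi : field) (s : seq (site d)) :
    {measure set field -> \bar R} :=
  if s is x :: s' then lebesgue_add (lebesgue_seq xi s') x else dirac xi.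

(* prod_(x in Lam) dphi_x, carried by the fields equal to xi off Lam *)
Definition lebesgue_on (Lam : {fset site d}) (xi : field) :=
  lebesgue_seq xi (enum_fset Lam).

End Lebesgue.

Section Density.
Context d (T : measurableType d) (R : realType).
Variables (m : {measure set T -> \bar R}) (f : T -> R).
Hypothesis mf : measurable_fun setT f.
Hypothesis f0 : forall x, 0 <= f x.

Definition density (_ : measurable_fun setT f) (_ : forall x, 0 <= f x) :
  set T -> \bar R := fun A => (\int[m]_(x in A) (f x)%:E)%E.

Let de0 : density mf f0 set0 = 0%E.
Proof. exact: integral_set0. Qed.
Let de_ge0 A : (0 <= density mf f0 A)%E.
Proof. by apply: integral_ge0 => x _; rewrite lee_fin. Qed.
Let de_sigma : semi_sigma_additive (density mf f0).
Proof.
move=> F mF tF mUF.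
rewrite /density ge0_integral_bigcup//=.
- by apply: is_cvg_ereal_nneg_natsum_cond => n _ _; exact: de_ge0.
- by apply/measurable_EFinP; exact: measurable_funTS.
- by move=> x _; rewrite lee_fin.
Qed.
HB.instance Definition _ := isMeasure.Build _ _ _ (density mf f0)
  de0 de_ge0 de_sigma.
End Density.

Section ContinuousMeasurable.
Context (R : realType) (k : nat).

Lemma measurable_comp_rV d (T : measurableType d) (f : 'rV[R]_k -> R)
    (g : T -> 'rV[R]_k) :
  continuous f -> (forall i, measurable_fun setT (fun w => g w ord0 i)) ->
  measurable_fun setT (f \o g).
Proof.
move=> cf mg; apply: (measurability _ (RGenOpens.measurableE R)) => //.
move=> _ [_ [a [b ->]] <-]; rewrite setTI.
pose O := f @^-1` `]a, b[%classic.
have oO : open O by apply: open_comp => //; exact: interval_open.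
pose ctr (p : 'rV[rat]_k * nat) : 'rV[R]_k := map_mx ratr p.1.
pose Bl p := [set x : 'rV[R]_k | forall i, `|ctr p ord0 i - x ord0 i| < p.2.+1%:R^-1].
have -> : (f \o g) @^-1` `]a, b[%classic =
    \bigcup_(p in [set p | Bl p `<=` O]) (g @^-1` Bl p).
  apply/seteqP; split => [w Ow|w [p pO] /pO//].
  have /nbhs_ballP[e /= e0 eO] : nbhs (g w) O by apply: open_nbhs_nbhs; split.
  have e20 : 0 < e / 2 by rewrite divr_gt0.
  have [n _ /(_ n (leqnn n)) /= ne] := near_infty_natSinv_lt (PosNum e20).
  have /choice[q qP] : forall i : 'I_k, exists q : rat,
      `|ratr q - g w ord0 i| < n.+1%:R^-1 :> R.
    move=> i; have /rat_in_itvoo[q] : g w ord0 i < g w ord0 i + n.+1%:R^-1.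
      by rewrite ltrDl invr_gt0.
    rewrite in_itv /= => /andP[q1 q2]; exists q.
    by rewrite gtr0_norm ?subr_gt0// ltrBlDl.
  exists (\row_i q i, n); last by move=> i; rewrite !mxE; exact: qP.
  move=> x xB; apply: eO; split => // i j; rewrite ord1.
  have := xB j; rewrite !mxE => xBj.
  rewrite /ball /=.
  have -> : g w ord0 j - x ord0 j =
      (ratr (q j) - x ord0 j) - (ratr (q j) - g w ord0 j).
    by rewrite opprB [RHS]addrC addrA subrK.
  rewrite (le_lt_trans (ler_normB _ _))// [ltRHS]splitr ltrD//.
    exact: lt_trans ne.
  exact: lt_trans (qP j) ne.
rewrite bigcup_mkcond; apply: countable_bigcupT_measurable => [|p].
  exact: countableP.
case: ifP => _; last exact: measurable0.
have -> : g @^-1` Bl p = \bigcap_(i in [set: 'I_k])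
    (fun w => `|ctr p ord0 i - g w ord0 i|) @^-1` `]-oo, p.2.+1%:R^-1[%classic.
  apply/seteqP; split => w /= h i; first by move=> _; rewrite /= in_itv /=.
  by have := h i I; rewrite /= in_itv.
apply: fin_bigcap_measurable => // i _.
rewrite -[X in measurable X]setTI.
apply: (@measurableT_comp _ _ _ _ _ _ (fun x : R => `|ctr p ord0 i - x|) _
  (fun w => g w ord0 i)) => //.
apply: measurableT_comp => //; exact: measurable_funB.
Qed.

End ContinuousMeasurable.

Section Potentials.
Variables (R : realType) (d : nat) (Gam : {fset site d}).
Local Notation field := (field R d).

Definition nabla (phi : field) (e : site d * site d) : R := phi e.2 - phi e.1.

(* R^(E(X)) for X = B(x,1) is 'rV[R]_#|` Gam|: the coordinate i is the edge
   (x, x + step i). *)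
Definition step (i : 'I_#|` Gam|) : site d := (enum_fset Gam)`_i.

Definition star_gradient (x : site d) (phi : field) : 'rV[R]_#|` Gam| :=
  \row_i nabla phi (x, x + step i).

Definition bump_at (x : site d) (t : R) (phi : field) : field :=
  fun z => if z == x then phi z + t else phi z.

Definition partial (x : site d) (F : field -> R) : field -> R :=
  fun phi => derive1 (fun t : R => F (bump_at x t phi)) 0.

Definition pderiv k (i : 'I_k) (f : 'rV[R]_k -> R) : 'rV[R]_k -> R :=
  fun eta => 'D_(delta_mx ord0 i) f eta.

Definition C2_hoelder k (alpha : R) (f : 'rV[R]_k -> R) : Prop :=
  [/\ continuous f,
      forall i eta, derivable f eta (delta_mx ord0 i),
      forall i j eta, derivable (pderiv i f) eta (delta_mx ord0 j),
      (forall i, continuous (pderiv i f)) /\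
      (forall i j, continuous (pderiv j (pderiv i f))) &
      exists C : R, forall i j eta eta',
        `|pderiv j (pderiv i f) eta - pderiv j (pderiv i f) eta'|
          <= C * `|eta - eta'| `^ alpha].

(* The family (V_X)_X is indexed by the centre x of X = B(x,1). *)
Record potential (c0 alpha : R) := Potential {
  pot :> site d -> 'rV[R]_#|` Gam| -> R;
  pot_ge0 : forall x eta, 0 <= pot x eta;
  pot_smooth : forall x, C2_hoelder alpha (pot x);
  pot_sym : forall x eta, pot x eta = pot x (- eta);
  pot_transl : forall a x (phi : field),
    pot (x + a) (star_gradient (x + a) phi)
    = pot x (\row_i nabla phi (x + a, x + step i + a));
  pot_convex : forall x y (phi : field), adj Gam x y ->
    c0^-1 <= - (\sum_(z \in [set z | gball Gam z 1 x /\ gball Gam z 1 y])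
                  partial x (partial y (pot z \o star_gradient z)) phi) <= c0;
  pot_range : forall z x y (phi : field), x != y -> ~~ adj Gam x y ->
    partial x (partial y (pot z \o star_gradient z)) phi = 0
}.

Variables (c0 alpha : R) (V : potential c0 alpha).

Definition hamiltonian (Lam : {fset site d}) (phi : field) : R :=
  \sum_(x \in [set x | gball Gam x 1 `&` [set` Lam] !=set0])
    V x (star_gradient x phi).

Definition boltzmann (Lam : {fset site d}) (phi : field) : R :=
  expR (- hamiltonian Lam phi).

Lemma boltzmann_ge0 Lam phi : 0 <= boltzmann Lam phi.
Proof. exact: expR_ge0. Qed.

Lemma measurable_boltzmann Lam : measurable_fun setT (boltzmann Lam).
Proof.
apply: measurableT_comp => //; apply: measurableT_comp => //.
rewrite /hamiltonian.
under eq_fun do rewrite (fsbig_finite _ _ (finite_touching Gam Lam)).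
apply: measurable_sum => x.
apply: (@measurable_comp_rV _ _ _ _ (V x) (star_gradient x)).
  by case: (pot_smooth V x).
move=> i; rewrite /star_gradient /nabla /=; under eq_fun do rewrite mxE.
by apply: measurable_funB; exact: measurable_coord.
Qed.

(* Normalized by its total mass; the degenerate branch of [mnormalize] is never
   taken for the potentials above. *)
Definition gibbs (Lam : {fset site d}) (xi : field) : probability field R :=
  mnormalize
    (density (lebesgue_on Lam xi) (measurable_boltzmann Lam) (boltzmann_ge0 Lam))
    (dirac xi).

Definition gibbs_pair (Lam : {fset site d}) : set (field * field) -> \bar R :=
  (gibbs Lam (fun=> 0%R) \x gibbs Lam (fun=> 0%R))%E.

Definition jump_rate (Lam : {fset site d}) (z y : site d) (phi : field) : R :=
  - partial z (partial y (hamiltonian Lam)) phi.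

End Potentials.

Section Probability.
Context (R : realType) (d' : measure_display) (T : measurableType d').
Variable P : probability T R.

Definition independent_families (I : choiceType) (F : I -> set (set T)) : Prop :=
  forall (J : {fset I}) (A : I -> set T), (forall i, F i (A i)) ->
    P (\bigcap_(i in [set` J]) A i) = (\prod_(i <- J) P (A i))%E.

Definition sigma_rv (Y : T -> R) : set (set T) :=
  preimage_set_system setT Y measurable.

Definition std_exponential (Y : T -> R) : Prop :=
  measurable_fun setT Y /\
  forall A : set R, measurable A -> P (Y @^-1` A) = exponential_prob 1 A.

(* E[f | A], and 0 if P A = 0 *)
Definition cond_expectation (A : set T) (f : T -> R) : R :=
  fine (\int[P]_(w in A) (f w)%:E) / fine (P A).

End Probability.

Section LangevinWalk.
Variables (R : realType) (d : nat) (Gam : {fset site d}) (c0 alpha : R).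
Variable V : potential Gam c0 alpha.
Variables (Lam : {fset site d}) (xi : field R d) (x : site d) (phi : field R d).

Section Realization.
Context (d' : measure_display) (T : measurableType d') (P : probability T R).

(* Independent standard Brownian motions B, and i.i.d. standard exponential
   clocks independent of them; the times t below are arbitrary. *)
Record noise (B : Lam -> R -> T -> R) (clock : nat -> Gam -> T -> R) : Prop := {
  noise_meas : forall z t, 0 <= t -> measurable_fun setT (B z t);
  noise_cont : forall z w, {within `[0, +oo[, continuous (fun t => B z t w)};
  noise_start : forall z w, B z 0 w = 0;
  noise_gauss : forall z (s t : R) (A : set R), 0 <= s -> s < t -> measurable A ->
    P ((fun w => B z t w - B z s w) @^-1` A) = normal_prob 0 (Num.sqrt (t - s)) A;
  noise_clock : forall k y, std_exponential P (clock k y);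
  noise_indep : forall t : nat -> R, 0 <= t 0%N -> {homo t : m n / (m <= n)%N >-> m <= n} ->
    independent_families P (fun i : (Lam * nat) + (nat * Gam) =>
      match i with
      | inl (z, n) => sigma_rv (fun w => B z (t n.+1) w - B z (t n) w)
      | inr (k, y) => sigma_rv (clock k y)
      end)
}.

(* The noise being additive, the equation for Phi is an integral equation
   satisfied path by path. *)
Record langevin (B : Lam -> R -> T -> R) (Phi : R -> T -> field R d) : Prop := {
  langevin_meas : forall t, 0 <= t -> measurable_fun setT (Phi t);
  langevin_cont : forall z w, {within `[0, +oo[, continuous (fun t => Phi t w z)};
  langevin_in : forall (z : Lam) t w, 0 <= t ->
    Phi t w (val z) = phi (val z)
      - \int[lebesgue_measure]_(s in `[0, t])
           partial (val z) (hamiltonian V Lam) (Phi s w)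
      + Num.sqrt 2 * B z t w;
  langevin_out : forall z t w, 0 <= t -> z \notin Lam -> Phi t w z = xi z
}.

(* The jump process X with rates jump_rate V Lam z y (Phi t), given Phi, built
   with competing exponential clocks: jt k is its k-th jump time and Y k its
   position from then on.  The walk waits in Y k until the first of the
   integrated rates towards the neighbours of Y k reaches its clock. *)
Record environment_walk (clock : nat -> Gam -> T -> R) (Phi : R -> T -> field R d)
    (X : R -> T -> site d) : Prop := {
  walk_meas : forall t y, 0 <= t -> measurable (X t @^-1` [set y]);
  walk_path : forall w, exists (jt : nat -> R) (Y : nat -> site d),
    let hazard k (y : Gam) := \int[lebesgue_measure]_(s in `[jt k, jt k.+1])
      jump_rate V Lam (Y k) (Y k + val y) (Phi s w) in
    [/\ jt 0%N = 0 /\ Y 0%N = x,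
        forall k, Y k \in Lam -> exists y : Gam,
          [/\ jt k < jt k.+1, Y k.+1 = Y k + val y, hazard k y = clock k y w &
              forall y' : Gam, y' != y -> hazard k y' < clock k y' w],
        forall k, Y k \notin Lam -> jt k.+1 = jt k /\ Y k.+1 = Y k &
        forall t, 0 <= t -> exists k,
          [/\ jt k <= t, (Y k \in Lam -> t < jt k.+1) & X t w = Y k]]
}.

Definition langevin_walk (Phi : R -> T -> field R d) (X : R -> T -> site d) : Prop :=
  exists (B : Lam -> R -> T -> R) (clock : nat -> Gam -> T -> R),
    [/\ noise B clock, langevin B Phi & environment_walk clock Phi X].

(* If X never leaves K this is inf set0 = 0; this has probability 0, and then
   exit_site below is the starting point. *)
Definition exit_time (X : R -> T -> site d) (K : {fset site d}) (w : T) : R :=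
  inf [set t | 0 < t /\ X t w \notin K].

Definition exit_site (X : R -> T -> site d) (w : T) : site d :=
  X (exit_time X Lam w) w.

End Realization.

(* E_(x,phi)[f(X_tau) | X_tau in A], tau being the exit time from Lam.  The law
   of (X, Phi) does not depend on the probability space and the processes that
   realize it, so the set below is a singleton. *)
Definition cond_exit_expectation (A : set (site d)) (f : site d -> R) : R :=
  xget 0 [set r | exists (d' : measure_display) (T : measurableType d')
    (P : probability T R) (Phi : R -> T -> field R d) (X : R -> T -> site d),
    langevin_walk P Phi X /\
    r = cond_expectation P (exit_site X @^-1` A) (f \o exit_site X)].

End LangevinWalk.

Section Event.
Variables (R : realType) (d : nat) (Gam : {fset site d}) (c0 alpha : R).
Variable V : potential Gam c0 alpha.
Variables (S S' : {fset site d}) (eps : R).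
Local Notation field := (field R d).

(* Only its values off Lam `\` S' matter. *)
Definition boundary_condition (om : field * field) (t : R) : field :=
  fun x => if x \in S' then (1 - t) * om.1 x + t * (om.2 x + eps) else t * eps.

Definition extend (L : {fset site d}) (q : {ffun L -> rat}) (xi : field) : field :=
  fun z => if insub z is Some u then ratr (q u) else xi z.

Definition bad_event (Lam : {fset site d}) (M : R) : set (field * field) :=
  let Lam' := (Lam `\` S')%fset in
  \bigcup_(t in [set t : rat | 0 <= t <= 1])
  \bigcup_(p in [set p : site d * {ffun Lam' -> rat} | p.1 \in S])
    [set om | let xi := boundary_condition om (ratr t) in
       cond_exit_expectation V Lam' xi p.1 (extend p.2 xi)
         (inner_boundary Gam [set` S']) (fun z => om.1 z - om.2 z) > M].

End Event.

Section SimpleRandomWalk.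
Variables (R : realType) (d : nat) (Gam : {fset site d}).

Section Realization.
Context (d' : measure_display) (T : measurableType d') (P : probability T R).

(* J are the steps and W the holding times of the walk Z. *)
Definition srw (x : site d) (Z : R -> T -> site d) : Prop :=
  exists (J : nat -> T -> Gam) (W : nat -> T -> R),
    [/\ forall k, std_exponential P (W k),
        forall k y, measurable (J k @^-1` [set y]) /\
          P (J k @^-1` [set y]) = (#|` Gam|%:R^-1)%:E,
        independent_families P (fun i : nat + nat =>
          match i with
          | inl k => preimage_set_system setT (J k) setT
          | inr k => sigma_rv (W k)
          end) &
        forall w, (forall k, 0 < W k w) /\
          forall t, 0 <= t -> exists n,
            \sum_(k < n) W k w <= t < \sum_(k < n.+1) W k w /\
            Z t w = x + \sum_(k < n) val (J k w)].

Definition return_time (U : {fset site d}) (Z : R -> T -> site d) (w : T) : \bar R :=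
  ereal_inf (EFin @` [set t | [/\ 0 < t, Z t w \in U &
    exists s, 0 < s < t /\ Z s w <> Z 0 w]]).

End Realization.

(* As above, these values do not depend on the realization of the walk. *)
Definition green (x y : site d) : R :=
  xget 0 [set r | exists (d' : measure_display) (T : measurableType d')
    (P : probability T R) (Z : R -> T -> site d), srw P x Z /\
    r = fine (\int[P]_w \int[lebesgue_measure]_(t in `[0%R, +oo[)
               (\1_[set s | Z s w = y] t)%:E)%E].

Definition no_return_prob (U : {fset site d}) (y : site d) : R :=
  xget 0 [set r | exists (d' : measure_display) (T : measurableType d')
    (P : probability T R) (Z : R -> T -> site d), srw P y Z /\
    r = fine (P [set w | return_time U Z w = +oo%E])].

Definition equilibrium (U : {fset site d}) (y : site d) : R :=
  no_return_prob U y * (y \in U)%:R.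

Definition capacity (U : {fset site d}) : R := \sum_(y <- U) equilibrium U y.

Definition sigma_star (S S' : {fset site d}) : R :=
  sup [set sup [set green x y | y in [set` S']] / inf [set green x y | y in [set` S']]
      | x in [set` S]].

End SimpleRandomWalk.

(* Main.v *)
From HB Require Import structures.
Require Import Defs.
From mathcomp Require Import all_boot all_order all_algebra finmap.
From mathcomp Require Import all_classical all_reals all_analysis.
From mathcomp Require Import measurable_realfun.
From mathcomp Require Import ring lra zify.

Set Implicit Arguments.
Unset Strict Implicit.
Unset Printing Implicit Defensive.

Import Order.TTheory GRing.Theory Num.Theory.
Import numFieldNormedType.Exports.
Import HBNNSimple.

Local Open Scope classical_set_scope.
Local Open Scope ring_scope.

(** The exit site of the walk, conditioned on landing in the inner boundary of
    S', lies in that boundary, so the conditional expectation in the bad event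
    never exceeds the maximum of phi - phi~ over the inner boundary.  The bad
    event is thus contained in the event that phi_y - phi~_y > M for some y in
    the inner boundary ([bad_event_sub]).  On the other side of the inequality,
    cap*(S') <= |inner boundary of S'|, because an interior point of S' has zero
    escape probability, and sigma* >= 1 unless it is 0, so that the ratio
    multiplying M_infty is at most 1 ([capacity_ratio]); also n <= 2^n.
    Everything reduces to a Gaussian tail for a single coordinate of the Gibbs
    measure with zero boundary condition, uniform in the domain and in the
    coordinate.

    That tail comes from convexity.  Since V_X depends on gradients only, the
    Hessian of H has vanishing row and column sums, hence it is the quadratic
    form of a network whose conductances on the edges touching Lambda are at
    least 1/c_0 ([conductance_ge]): it dominates the Dirichlet energy of the
    step graph.  In dimension at least 3 this graph is transient, i.e.
    u(y)^2 <= C E(u) for every finitely supported u ([transience_inequality]).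
    Together they give
    H(phi) + H(psi) - 2 H((phi + psi)/2) >= kappa (phi_y - psi_y)^2
    for every y ([hamiltonian_convex]), with kappa depending on d, Gamma and c_0.

    Completing the square, e^{-H(phi) + l phi_y} e^{-H(psi) - l psi_y} is at most
    the square of e^{l^2/(8 kappa)} e^{-H} at the midpoint.  The
    Prekopa-Leindler inequality ([prekopa_leindler]) integrates this pointwise
    bound; since H is even, the two integrals on the left agree, and
    E[e^{l phi_y}] <= e^{l^2/(8 kappa)} ([tilted_moment]).  Chernoff's bound
    then yields the tail ([gibbs_tail]).

    Transience is proved by Thomson's principle, with the flow of Polya's urn on
    a three-dimensional octant.  Prekopa-Leindler is proved by integrating out
    one coordinate at a time, from the one-dimensional Brunn-Minkowski
    inequality for level sets. *)

(** * A unit flow of finite energy on the octant *)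

Section Flow.
Variable R : realFieldType.

Lemma cauchy_schwarz_sum (I : finType) (a b : I -> R) :
  (\sum_i a i * b i) ^+ 2 <= (\sum_i a i ^+ 2) * (\sum_i b i ^+ 2).
Proof.
set A := \sum_i a i ^+ 2; set B := \sum_i b i ^+ 2; set C := \sum_i a i * b i.
have : 0 <= \sum_i \sum_j (a i * b j - a j * b i) ^+ 2.
  by apply: sumr_ge0 => i _; apply: sumr_ge0 => j _; exact: sqr_ge0.
have -> : \sum_i \sum_j (a i * b j - a j * b i) ^+ 2 = (A * B - C ^+ 2) *+ 2.
  transitivity (\sum_i (a i ^+ 2 * B + b i ^+ 2 * A - (a i * b i) * C *+ 2)).
    apply: eq_bigr => i _; rewrite /A /B /C !mulr_sumr -sumrMnl.
    by rewrite -big_split -sumrB; apply: eq_bigr => j _ /=; ring.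
  by rewrite sumrB big_split /= -!mulr_suml sumrMnl -mulr_suml -/A -/B -/C; ring.
by rewrite pmulrn_lge0// subr_ge0.
Qed.

Lemma sum_by_parts (N : nat) (th w : nat -> R) : w N = 0 ->
  \sum_(i < N) th i.+1 * (w i - w i.+1) =
  \sum_(i < N) (th i.+1 - th i) * w i + th 0%N * w 0%N.
Proof.
move=> wN; suff : \sum_(i < N) th i.+1 * (w i - w i.+1) =
  \sum_(i < N) (th i.+1 - th i) * w i + th 0%N * w 0%N - th N * w N.
  by rewrite wN mulr0 subr0.
by elim: N {wN} => [|N IH]; rewrite ?big_ord0 ?big_ord_recr /= ?IH; ring.
Qed.

(** Polya's urn started from one ball of each of three colours is uniform on the
    (n+1)(n+2)/2 points of the simplex i + j + k = n.  The unit flow it induces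
    on the octant sends (i+1) * [urn_weight n.+1] through the edge from (i, j, k)
    to (i+1, j, k), and likewise in the other two directions.  The index is
    shifted so that the edge ending at (i, j, k) carries i * [urn_weight (i+j+k)],
    which is 0 when i = 0. *)
Definition urn_weight (n : nat) : R := 2 / (n%:R * n.+1%:R * n.+2%:R).

(** Conservation of the flow away from the origin, where it has a unit source. *)
Lemma urn_divergence n :
  n.+3%:R * urn_weight n.+1 - n%:R * urn_weight n = (n == 0%N)%:R.
Proof.
case: n => [|n]; rewrite /urn_weight ?mul0r ?subr0 /=.
  by field.
have n0 : 0 <= n%:R :> R by [].
rewrite -!natr1; field.
by repeat (apply/andP; split); apply: lt0r_neq0; lra.
Qed.

(** Pairing the gradient of u with the flow recovers u at the source: summation
    by parts in each direction moves the difference onto the flow. *)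
Lemma urn_flow N (u : nat -> nat -> nat -> R) :
  (0 < N)%N ->
  (forall j k, u N j k = 0) -> (forall i k, u i N k = 0) ->
  (forall i j, u i j N = 0) ->
  u 0%N 0%N 0%N = \sum_(i < N) \sum_(j < N) \sum_(k < N)
    (i.+1%:R * urn_weight (i + j + k).+1 * (u i j k - u i.+1 j k)
     + j.+1%:R * urn_weight (i + j + k).+1 * (u i j k - u i j.+1 k)
     + k.+1%:R * urn_weight (i + j + k).+1 * (u i j k - u i j k.+1)).
Proof.
move=> N0 u1 u2 u3; pose c := urn_weight.
have s1 : \sum_(i < N) \sum_(j < N) \sum_(k < N)
     i.+1%:R * c (i + j + k).+1 * (u i j k - u i.+1 j k) =
   \sum_(i < N) \sum_(j < N) \sum_(k < N)
     (i.+1%:R * c (i + j + k).+1 - i%:R * c (i + j + k)%N) * u i j k.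
  rewrite exchange_big [RHS]exchange_big; apply: eq_bigr => j _ /=.
  rewrite exchange_big [RHS]exchange_big; apply: eq_bigr => k _ /=.
  have := @sum_by_parts N (fun i => i%:R * c (i + j + k)%N) (fun i => u i j k) (u1 _ _).
  by move=> /= ->; rewrite !mul0r addr0.
have s2 : \sum_(i < N) \sum_(j < N) \sum_(k < N)
     j.+1%:R * c (i + j + k).+1 * (u i j k - u i j.+1 k) =
   \sum_(i < N) \sum_(j < N) \sum_(k < N)
     (j.+1%:R * c (i + j + k).+1 - j%:R * c (i + j + k)%N) * u i j k.
  apply: eq_bigr => i _ /=.
  rewrite exchange_big [RHS]exchange_big; apply: eq_bigr => k _ /=.
  have := @sum_by_parts N (fun j => j%:R * c (i + j + k)%N) (fun j => u i j k) (u2 _ _).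
  rewrite /= mul0r mul0r addr0 => h.
  under eq_bigr => j _ do rewrite -addSn -addnS.
  by rewrite h; apply: eq_bigr => j _; rewrite addnS addSn.
have s3 : \sum_(i < N) \sum_(j < N) \sum_(k < N)
     k.+1%:R * c (i + j + k).+1 * (u i j k - u i j k.+1) =
   \sum_(i < N) \sum_(j < N) \sum_(k < N)
     (k.+1%:R * c (i + j + k).+1 - k%:R * c (i + j + k)%N) * u i j k.
  apply: eq_bigr => i _ /=; apply: eq_bigr => j _ /=.
  have := @sum_by_parts N (fun k => k%:R * c (i + j + k)%N) (fun k => u i j k) (u3 _ _).
  rewrite /= mul0r mul0r addr0 => h.
  under eq_bigr => k _ do rewrite -addnS.
  by rewrite h; apply: eq_bigr => k _; rewrite addnS.
under [RHS]eq_bigr => i _ do under eq_bigr => j _ do rewrite !big_split /=.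
under [RHS]eq_bigr => i _ do rewrite !big_split /=.
rewrite !big_split /= s1 s2 s3 -!big_split /=.
under [RHS]eq_bigr => i _.
  rewrite -!big_split /=.
  under eq_bigr => j _.
    rewrite -!big_split /=.
    under eq_bigr => k _.
      rewrite -!mulrDl.
      have -> : i.+1%:R * c (i + j + k).+1 - i%:R * c (i + j + k)%N +
          (j.+1%:R * c (i + j + k).+1 - j%:R * c (i + j + k)%N) +
          (k.+1%:R * c (i + j + k).+1 - k%:R * c (i + j + k)%N) =
          ((i + j + k) == 0)%N%:R.
        rewrite -urn_divergence -/c -!natr1 !natrD; ring.
      over.
    over.
  over.
case: N N0 {u1 u2 u3 s1 s2 s3} => // N _.
rewrite big_ord_recl /= big_ord_recl /= big_ord_recl /= mul1r.
rewrite big1 ?addr0; last by move=> k _; rewrite mul0r.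
rewrite big1 ?addr0; last by move=> j _; apply: big1 => k _; rewrite mul0r.
rewrite big1 ?addr0// => i _; apply: big1 => j _; apply: big1 => k _.
by rewrite mul0r.
Qed.

Lemma telescope_le N (F T : nat -> R) : (forall i, F i <= T i - T i.+1) ->
  (forall i, 0 <= T i) -> \sum_(i < N) F i <= T 0%N.
Proof.
move=> FT T0; suff : \sum_(i < N) F i <= T 0%N - T N.
  by move=> /le_trans; apply; rewrite lerBlDr lerDl.
elim: N => [|N IH]; first by rewrite big_ord0 subrr.
by rewrite big_ord_recr /=; have := FT N; move: IH; lra.
Qed.

(** The energy is summable precisely because there are three directions: the
    outflow of a vertex at level n = i + j + k is 2/((n+1)(n+2)), and the squares
    of these numbers telescope three times, through 1/((n+1)(n+2)(n+3)), then
    1/((n+1)(n+2)), then 1/(n+1). *)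
Lemma urn_energy N : \sum_(i < N) \sum_(j < N) \sum_(k < N)
    ((i.+1%:R * urn_weight (i + j + k).+1) ^+ 2 + (j.+1%:R * urn_weight (i + j + k).+1) ^+ 2
     + (k.+1%:R * urn_weight (i + j + k).+1) ^+ 2) <= 4.
Proof.
have n0 (n : nat) : 0 <= n%:R :> R by [].
have pos (n m : nat) : 0 < n%:R + m.+1%:R :> R by rewrite -natrD ltr0n addnS.
pose r1 (n : nat) : R := 4 * (n%:R + 1)^-1.
pose r2 (n : nat) : R := 4 * ((n%:R + 1) * (n%:R + 2))^-1.
pose r3 (n : nat) : R := 8 * ((n%:R + 1) * (n%:R + 2) * (n%:R + 3))^-1.
have r1_ge0 n : 0 <= r1 n by rewrite mulr_ge0// invr_ge0 ltW// (pos n 0%N).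
have r2_ge0 n : 0 <= r2 n.
  by rewrite mulr_ge0// invr_ge0 ltW// mulr_gt0// ?(pos n 0%N) ?(pos n 1%N).
have r3_ge0 n : 0 <= r3 n.
  by rewrite mulr_ge0// invr_ge0 ltW// !mulr_gt0// ?(pos n 0%N) ?(pos n 1%N) ?(pos n 2%N).
have r1E n : r2 n <= r1 n - r1 n.+1.
  rewrite le_eqVlt; apply/orP; left; apply/eqP; rewrite /r1 /r2 -natr1; field.
  by have ? := n0 n; repeat (apply/andP; split); apply: lt0r_neq0; lra.
have r2E n : r3 n <= r2 n - r2 n.+1.
  rewrite le_eqVlt; apply/orP; left; apply/eqP; rewrite /r3 /r2 -natr1; field.
  by have ? := n0 n; repeat (apply/andP; split); apply: lt0r_neq0; lra.
have edge i j k : (i.+1%:R * urn_weight (i + j + k).+1) ^+ 2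
   + (j.+1%:R * urn_weight (i + j + k).+1) ^+ 2
   + (k.+1%:R * urn_weight (i + j + k).+1) ^+ 2 <= r3 (i + j + k)%N - r3 (i + j + k).+1.
  set n := (i + j + k)%N.
  have := (n0 i, n0 j, n0 k); move=> [[i0 j0] k0].
  have nE : n%:R = i%:R + j%:R + k%:R :> R by rewrite /n !natrD.
  have {}n0 := n0 n.
  have u0 : 0 <= urn_weight n.+1 by rewrite /urn_weight divr_ge0// !mulr_ge0.
  apply: (@le_trans _ _ (((n%:R + 3) * urn_weight n.+1) ^+ 2)).
    move: (urn_weight _) u0 => w _; rewrite !exprMn -!mulrDl ler_wpM2r ?sqr_ge0//.
    by rewrite nE -!natr1; nra.
  have -> : (n%:R + 3) * urn_weight n.+1 = 2 / ((n%:R + 1) * (n%:R + 2)) :> R.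
    rewrite /urn_weight -!natr1; field.
    by repeat (apply/andP; split); apply: lt0r_neq0; lra.
  have -> : r3 n - r3 n.+1 = 24 / ((n%:R + 1) * (n%:R + 2) * (n%:R + 3) * (n%:R + 4)).
    rewrite /r3 -natr1; field.
    by repeat (apply/andP; split); apply: lt0r_neq0; lra.
  rewrite expr_div_n ler_pdivrMr; last first.
    by rewrite exprn_gt0// mulr_gt0// ?(pos n 0%N) ?(pos n 1%N).
  rewrite mulrAC ler_pdivlMr; last first.
    by rewrite !mulr_gt0// ?(pos n 0%N) ?(pos n 1%N) ?(pos n 2%N) ?(pos n 3%N).
  set m : R := n%:R in n0 *.
  have h : 0 <= (m + 1) * (m + 2) by nra.
  have -> : 2 ^+ 2 * ((m + 1) * (m + 2) * (m + 3) * (m + 4)) =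
    (4 * (m + 3) * (m + 4)) * ((m + 1) * (m + 2)) by ring.
  have -> : 24 * ((m + 1) * (m + 2)) ^+ 2 =
    (24 * (m + 1) * (m + 2)) * ((m + 1) * (m + 2)) by ring.
  by apply: ler_wpM2r => //; nra.
apply: (@le_trans _ _ (\sum_(i < N) r2 i)); last first.
  apply: (@le_trans _ _ (r1 0%N)); first exact: telescope_le.
  by rewrite /r1 add0r invr1 mulr1.
apply: ler_sum => i _.
apply: (@le_trans _ _ (\sum_(j < N) r3 (i + j)%N)).
  apply: ler_sum => j _.
  rewrite -[(i + j)%N in leRHS]addn0.
  by refine (@telescope_le N _ (fun k => r3 (i + j + k)%N) _ _) => // k; rewrite addnS; exact: edge.
rewrite -[nat_of_ord i in leRHS](addn0 i).
by refine (@telescope_le N (fun j => r3 (i + j)%N) (fun j => r2 (i + j)%N) _ _) => // j; rewrite addnS.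
Qed.

Lemma octant_bound N (u : nat -> nat -> nat -> R) :
  (0 < N)%N ->
  (forall j k, u N j k = 0) -> (forall i k, u i N k = 0) ->
  (forall i j, u i j N = 0) ->
  u 0%N 0%N 0%N ^+ 2 <= 4 * \sum_(p : 'I_N * 'I_N * 'I_N)
    ((u p.1.1 p.1.2 p.2 - u p.1.1.+1 p.1.2 p.2) ^+ 2
     + (u p.1.1 p.1.2 p.2 - u p.1.1 p.1.2.+1 p.2) ^+ 2
     + (u p.1.1 p.1.2 p.2 - u p.1.1 p.1.2 p.2.+1) ^+ 2).
Proof.
move=> N0 u1 u2 u3; rewrite (urn_flow N0 u1 u2 u3) !pair_bigA /=.
pose T := ('I_N * 'I_N * 'I_N)%type.
pose a (p : T) (s : 'I_3) :=
  [:: p.1.1.+1%:R; p.1.2.+1%:R; p.2.+1%:R]`_s * urn_weight (p.1.1 + p.1.2 + p.2).+1.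
pose b (p : T) (s : 'I_3) :=
  [:: u p.1.1 p.1.2 p.2 - u p.1.1.+1 p.1.2 p.2;
      u p.1.1 p.1.2 p.2 - u p.1.1 p.1.2.+1 p.2;
      u p.1.1 p.1.2 p.2 - u p.1.1 p.1.2 p.2.+1]`_s.
have E (F : T -> 'I_3 -> R) : \sum_q F q.1 q.2 =
  \sum_p (F p ord0 + F p (lift ord0 ord0) + F p (lift ord0 (lift ord0 ord0))).
  rewrite -(pair_bigA _ F) /=; apply: eq_bigr => p _.
  by rewrite !big_ord_recl big_ord0 addr0 addrA.
have := cauchy_schwarz_sum (fun q => a q.1 q.2) (fun q => b q.1 q.2).
have Eab := E (fun p s => a p s * b p s); rewrite /= in Eab.
have Ea := E (fun p s => a p s ^+ 2); rewrite /= in Ea.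
have Eb := E (fun p s => b p s ^+ 2); rewrite /= in Eb.
rewrite Eab Ea Eb.
move=> /le_trans; apply; apply: ler_wpM2r.
  by apply: sumr_ge0 => p _; rewrite !addr_ge0 ?sqr_ge0.
by have := urn_energy N; rewrite !pair_bigA.
Qed.

End Flow.

(** * Transience of the step graph in dimension at least three *)

Section Transience.
Variable R : realType.

Lemma sum_injective_le (I : finType) (T : choiceType) (h : I -> T)
    (W : {fset T}) (F : T -> R) :
  injective h -> (forall x, 0 <= F x) -> (forall x, x \notin W -> F x = 0) ->
  \sum_i F (h i) <= \sum_(x <- W) F x.
Proof.
move=> hinj F0 FW.
have -> : \sum_i F (h i) = \sum_(x <- W) \sum_i (h i == x)%:R * F x.
  rewrite exchange_big; apply: eq_bigr => i _ /=.
  have [hW|hW] := boolP (h i \in W).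
    rewrite (big_fsetD1 (h i)) //= eqxx mul1r big_seq big1 ?addr0// => x.
    by rewrite !inE eq_sym => /andP[/negbTE -> _]; rewrite mul0r.
  rewrite FW// big_seq big1// => x xW; case: eqP => [hx|]; rewrite ?mul0r//.
  by rewrite hx xW in hW.
apply: ler_sum => x _; rewrite -mulr_suml ler_piMl//.
have [[i /eqP hi]|no] := pselect (exists i, h i == x).
  rewrite (bigD1 i)//= hi eqxx big1 ?addr0// => j ji; case: eqP => // hj.
  by case/eqP: ji; apply: hinj; rewrite hi.
rewrite big1 // => i _; case: eqP => // /eqP hi.
by case: no; exists i.
Qed.

Variables (d : nat) (Gam : {fset site d}).
Implicit Type u : site d -> R.

Definition local_energy u (x : site d) : R :=
  \sum_(g <- Gam) (u (x + g) - u x) ^+ 2.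

Lemma local_energy_ge0 u x : 0 <= local_energy u x.
Proof. by apply: sumr_ge0 => g _; exact: sqr_ge0. Qed.

(** Cauchy-Schwarz along the path from x that follows the steps in s. *)
Lemma path_energy u (s : seq (site d)) x : all (mem Gam) s ->
  (u x - u (x + \sum_(g <- s) g)) ^+ 2 <=
  (size s)%:R * \sum_(p < size s) local_energy u (x + \sum_(g <- take p s) g).
Proof.
move=> sG; pose v p := u (x + \sum_(g <- take p s) g).
have -> : u x - u (x + \sum_(g <- s) g) = \sum_(p < size s) (v p - v p.+1) * 1.
  under [RHS]eq_bigr do rewrite mulr1 -opprB.
  rewrite sumrN -(big_mkord xpredT (fun p => v p.+1 - v p)) telescope_sumr//.
  by rewrite /v take0 take_size big_nil addr0 opprB.
apply: (le_trans (cauchy_schwarz_sum _ _)); rewrite mulrC.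
under [X in X * _ <= _]eq_bigr do rewrite expr1n.
rewrite sumr_const card_ord -mulr_natl mulr1 ler_wpM2l//.
apply: ler_sum => p _.
have pG : nth 0 s p \in Gam by move/allP: sG => /(_ _ (mem_nth 0 (ltn_ord p))).
rewrite /local_energy (big_fsetD1 (nth 0 s p))//= /v.
rewrite (take_nth 0)// -cats1 big_cat big_seq1 addrA -sqrrN opprB lerDl.
by apply: sumr_ge0 => g _; exact: sqr_ge0.
Qed.

(** Three coordinate directions embed the octant at y.  Each unit vector is a
    sum of steps in Gam, so a coordinate gradient is controlled by the step
    energy along a path, and the translates of the octant meet each site once. *)
Lemma transience_inequality : (3 <= d)%N -> admissible_steps Gam ->
  exists2 C : R, 0 < C & forall (L W : {fset site d}) u,
    (forall x, x \notin L -> u x = 0) ->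
    (forall x g, x \notin W -> g \in Gam -> u (x + g) = u x) ->
    forall y, u y ^+ 2 <= C * \sum_(x <- W) local_energy u x.
Proof.
move=> d3 [_ _ gen].
have d0 : (0 < d)%N by lia. have d1 : (1 < d)%N by lia. have d2 : (2 < d)%N by lia.
pose e (c : 'I_d) : site d := delta_mx ord0 c.
pose c0 := Ordinal d0; pose c1 := Ordinal d1; pose c2 := Ordinal d2.
have [s0 [s0G e0]] := gen (e c0). have [s1 [s1G e1]] := gen (e c1).
have [s2 [s2G e2]] := gen (e c2).
exists (4 * ((size s0)%:R ^+ 2 + (size s1)%:R ^+ 2 + (size s2)%:R ^+ 2) + 1).
  by apply: ltr_wpDl => //; rewrite mulr_ge0// !addr_ge0// sqr_ge0.
move=> L W u uL uW y.
have lW x : x \notin W -> local_energy u x = 0.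
  move=> xW; rewrite /local_energy big_seq big1// => g gG.
  by rewrite uW// subrr expr0n.
set E := \sum_(x <- W) local_energy u x.
have E0 : 0 <= E by apply: sumr_ge0 => x _; exact: local_energy_ge0.
pose h (i j k : nat) : site d := y + e c0 *+ i + e c1 *+ j + e c2 *+ k.
have hc i j k c : (h i j k - y) ord0 c =
    ((c == c0) * i + (c == c1) * j + (c == c2) * k)%N%:R.
  rewrite /h -!scaler_nat !mxE /= !natrD !natrM.
  case: (c == c0); case: (c == c1); case: (c == c2) => /=; ring.
have hinj N : injective (fun p : 'I_N * 'I_N * 'I_N => h p.1.1 p.1.2 p.2).
  move=> [[i j] k] [[i' j'] k'] /= hh.
  have hc' c := congr1 (fun z : site d => (z - y) ord0 c) hh.
  have := (hc' c0, hc' c1, hc' c2); rewrite /= !hc /=.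
  rewrite !mul0n !mul1n !add0n !addn0 => -[[/eqP h0 /eqP h1] /eqP h2].
  move: h0 h1 h2; rewrite !eqr_nat => /eqP h0 /eqP h1 /eqP h2.
  by congr (_, _, _); apply: val_inj.
(* N exceeds every coordinate of z - y for z in L, so u vanishes at the points
   of the octant that have a coordinate equal to N. *)
pose spread (z : site d) := (\sum_c absz ((z - y)%R ord0 c))%N.
pose N := (\sum_(z <- L) spread z).+1.
have far i j k c : (h i j k - y) ord0 c = N%:R -> u (h i j k) = 0.
  move=> hN; apply: uL; apply/negP => hL.
  have := leqnn N; rewrite {1}/N (big_fsetD1 (h i j k))//= /spread (bigD1 c)//= hN.
  by rewrite natz absz_nat; lia.
have f1 j k : u (h N j k) = 0.
  by apply: (far _ _ _ c0); rewrite hc /= mul1n !mul0n !addn0.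
have f2 i k : u (h i N k) = 0.
  by apply: (far _ _ _ c1); rewrite hc /= mul1n !mul0n !addn0.
have f3 i j : u (h i j N) = 0.
  by apply: (far _ _ _ c2); rewrite hc /= mul1n !mul0n.
have -> : u y = u (h 0 0 0)%N by rewrite /h !mulr0n !addr0.
have := octant_bound (u := fun i j k => u (h i j k)) (ltn0Sn _) f1 f2 f3.
move=> /le_trans; apply.
rewrite [leRHS]mulrDl mul1r; apply: ler_wpDr => //; rewrite -[leRHS]mulrA ler_wpM2l//.
have bound (s : seq (site d)) ec : all (mem Gam) s -> ec = \sum_(g <- s) g ->
    \sum_(p : 'I_N * 'I_N * 'I_N)
      (u (h p.1.1 p.1.2 p.2) - u (h p.1.1 p.1.2 p.2 + ec)) ^+ 2 <=
    (size s)%:R ^+ 2 * E.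
  move=> sG ->.
  apply: (@le_trans _ _ (\sum_(p : 'I_N * 'I_N * 'I_N) (size s)%:R *
     \sum_(q < size s) local_energy u (h p.1.1 p.1.2 p.2 + \sum_(g <- take q s) g))).
    by apply: ler_sum => p _; exact: path_energy.
  rewrite -mulr_sumr expr2 -mulrA ler_wpM2l// exchange_big /=.
  rewrite mulr_natl -[X in _ *+ X]card_ord -sumr_const; apply: ler_sum => q _.
  apply: (@sum_injective_le _ _
    (fun p : 'I_N * 'I_N * 'I_N => h p.1.1 p.1.2 p.2 + \sum_(g <- take q s) g)
    W (local_energy u)) => //.
    by move=> p p' /= /addIr; exact: hinj.
  by move=> x; exact: local_energy_ge0.
rewrite !mulrDl !big_split /=; rewrite !lerD//.
- apply: le_trans (bound _ _ s0G e0); apply: ler_sum => p _.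
  by rewrite /h mulrSr !addrA; do 2!rewrite (addrAC _ (e c0)).
- apply: le_trans (bound _ _ s1G e1); apply: ler_sum => p _.
  by rewrite /h mulrSr !addrA; rewrite (addrAC _ (e c1)).
- apply: le_trans (bound _ _ s2G e2); apply: ler_sum => p _.
  by rewrite /h mulrSr !addrA.
Qed.

End Transience.

(** * Brunn-Minkowski on the line *)

Section Lebesgue1D.
Variable R : realType.
Local Notation leb := (@lebesgue_measure R).

(** The other endpoint of the segment with one endpoint b and midpoint t. *)
Definition dilation (b : R) (t : measurableTypeR R) : measurableTypeR R :=
  2 * t - b.

Lemma measurable_dilation (b : R) : measurable_fun setT (dilation b).
Proof. by apply: measurable_funB => //; apply: measurable_funM. Qed.

Lemma lebesgue_measure_double (b : R) (A : set R) : measurable A ->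
  leb A = (2%:E * leb (dilation b @^-1` A))%E.
Proof.
move=> mA.
unshelve refine (lebesgue_measure_unique
  (mu := mscale (2%:nng : {nonneg R}) (pushforward leb (dilation b))) _ mA).
  exact: measurable_dilation.
move=> _ [[x y] _ <-]; 
change (leb `]x, y]%classic = 2%:E * leb (dilation b @^-1` `]x, y]%classic))%E.
have -> : dilation b @^-1` `]x, y]%classic = `](x + b) / 2, (y + b) / 2]%classic.
  apply/seteqP; split => t; rewrite /dilation /= !in_itv /= => /andP[h1 h2].
    by apply/andP; split; lra.
  by apply/andP; split; lra.
rewrite !lebesgue_measure_itv /= !lte_fin; case: ltP => xy.
  by rewrite ifT ?lra//; [rewrite -!EFinB -EFinM; congr _%:E; field | lra].
by rewrite ifF ?mule0//; apply/negbTE; rewrite -leNgt; lra.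
Qed.

(** Continuity from below, tolerating one point of A that the F n may miss. *)
Lemma measure_approx_le (A : set R) (F : nat -> set R) (c : R) (K M : \bar R) :
  measurable A -> (forall n, measurable (F n)) -> nondecreasing_seq F ->
  A `<=` \bigcup_n F n `|` [set c] -> (0 <= K)%E ->
  (forall n, leb (F n) + K <= M)%E -> (leb A + K <= M)%E.
Proof.
move=> mA mF ndF AF K0 FM.
have [->|MNoo] := eqVneq M +oo%E; first by rewrite leey.
have Kfin : K \is a fin_num.
  rewrite ge0_fin_numE// lt_neqAle leey andbT; apply: contra MNoo => /eqP KE.
  have := FM 0%N; rewrite KE addey ?leye_eq// gt_eqF//.
  exact: lt_le_trans (ltNyr 0) (measure_ge0 _ _).
rewrite -leeBrDr//.
have mU : measurable (\bigcup_n F n) by exact: bigcup_measurable.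
apply: (@le_trans _ _ (leb (\bigcup_n F n))).
  apply: (@le_trans _ _ (leb (\bigcup_n F n) + leb [set c])%E).
    apply: le_trans (measureU2 _ _ _) => //.
    by apply: le_measure; rewrite ?inE//; apply: measurableU.
  by rewrite lebesgue_measure_set1 adde0.
have cF := nondecreasing_cvg_mu (mu := leb) mF mU ndF.
rewrite -(cvg_lim _ cF)//; apply: lime_le; first by apply/cvg_ex; eexists; exact: cF.
by apply: nearW => n /=; rewrite leeBrDr.
Qed.

(** The midpoints of b with points of A left of a, and of a with points of B
    right of b, lie in C on opposite sides of (a + b)/2; halving distances
    halves the measure. *)
Lemma brunn_minkowski_cut (A B C : set R) (a b : R) :
  measurable A -> measurable B -> measurable C ->
  (forall s t, A s -> B t -> C ((s + t) / 2)) -> A a -> B b ->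
  (leb (A `&` `]-oo, a[) + leb (B `&` `]b, +oo[) <= 2%:E * leb C)%E.
Proof.
move=> mA mB mC ABC Aa Bb.
have mA1 : measurable (A `&` `]-oo, a[) by apply: measurableI.
have mB1 : measurable (B `&` `]b, +oo[) by apply: measurableI.
rewrite (lebesgue_measure_double b mA1) (lebesgue_measure_double a mB1).
have mP (c : R) D : measurable D -> measurable (dilation c @^-1` D).
  by move=> mD; rewrite -[X in measurable X]setTI; exact: measurable_dilation.
rewrite -ge0_muleDr//; apply: lee_wpmul2l => //.
rewrite -measureU//; try exact: mP.
  apply: le_measure; rewrite ?inE//; first by apply: measurableU; exact: mP.
  move=> t [] /= [ABt]; rewrite /dilation in ABt * => _.
    by rewrite (_ : t = ((2 * t - b) + b) / 2); [exact: ABC | field].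
  by rewrite (_ : t = (a + (2 * t - a)) / 2); [exact: ABC | field].
rewrite -subset0 => t [[_]] /=; rewrite /dilation in_itv /= => h1 [_].
by rewrite in_itv /= andbT => h2; lra.
Qed.

(** In the cut inequality let a tend to sup A and b to inf B inside A and B; if
    the supremum or infimum is infinite, let them tend to infinity. *)
Lemma brunn_minkowski1 (A B C : set R) :
  measurable A -> measurable B -> measurable C ->
  (forall s t, A s -> B t -> C ((s + t) / 2)) -> A !=set0 -> B !=set0 ->
  (leb A + leb B <= 2%:E * leb C)%E.
Proof.
move=> mA mB mC ABC A0 B0.
have left_approx b : B b -> (leb A + leb (B `&` `]b, +oo[) <= 2%:E * leb C)%E.
  move=> Bb; have [Aub|/has_ubPn Anub] := pselect (has_ubound A).
    pose F n := A `&` `]-oo, sup A - n.+1%:R^-1[.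
    apply: (@measure_approx_le _ F (sup A)) => //.
    - by move=> n; apply: measurableI.
    - move=> m n mn; apply/subsetPset => t [At] /=; rewrite !in_itv /=.
      move=> /lt_le_trans tn; split => //=; rewrite in_itv /=; apply: tn.
      by rewrite lerB// lef_pV2 ?posrE// ler_nat.
    - move=> t At; have := ub_le_sup Aub At; rewrite le_eqVlt => /orP[/eqP ->|tA].
        by right.
      left; have d0 : 0 < sup A - t by rewrite subr_gt0.
      have [n _ /(_ n (leqnn n)) /= ne] := near_infty_natSinv_lt (PosNum d0).
      by exists n => //; split => //=; rewrite in_itv /= ltrBrDr -ltrBrDl.
    - move=> n; have /(sup_adherent)/(_ (conj A0 Aub))[a Aa sa] : 0 < n.+1%:R^-1 :> R by [].
      apply: le_trans (brunn_minkowski_cut mA mB mC ABC Aa Bb).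
      apply: leeD2r; apply: le_measure; rewrite ?inE; [exact: measurableI..|].
      move=> t [At] /=; rewrite in_itv /= => ts; split => //=.
      by rewrite in_itv /=; apply: lt_trans sa.
  pose F n := A `&` `]-oo, n%:R[.
  apply: (@measure_approx_le _ F 0) => //.
  - by move=> n; apply: measurableI.
  - move=> m n mn; apply/subsetPset => t [At] /=; rewrite !in_itv /=.
    move=> /lt_le_trans tn; split => //=; rewrite in_itv /=; apply: tn.
    by rewrite ler_nat.
  - move=> t At; left; exists (Num.truncn `|t|).+1 => //; split => //=.
    rewrite in_itv /= (le_lt_trans (ler_norm t))//.
    by have /andP[] := truncn_itv (normr_ge0 t).
  - move=> n; have [a Aa na] := Anub n%:R.
    apply: le_trans (brunn_minkowski_cut mA mB mC ABC Aa Bb).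
    apply: leeD2r; apply: le_measure; rewrite ?inE; [exact: measurableI..|].
    move=> t [At] /=; rewrite in_itv /= => ts; split => //=.
    by rewrite in_itv /=; apply: lt_trans na.
rewrite addeC.
have [Blb|/has_lbPn Bnlb] := pselect (has_lbound B).
  pose F n := B `&` `]inf B + n.+1%:R^-1, +oo[.
  apply: (@measure_approx_le _ F (inf B)) => //.
  - by move=> n; apply: measurableI.
  - move=> m n mn; apply/subsetPset => t [Bt] /=; rewrite !in_itv /= !andbT.
    move=> tn; split => //=; rewrite in_itv /= andbT; apply: le_lt_trans tn.
    by rewrite lerD2l lef_pV2 ?posrE// ler_nat.
  - move=> t Bt; have := ge_inf Blb Bt; rewrite le_eqVlt => /orP[/eqP <-|tB].
      by right.
    left; have d0 : 0 < t - inf B by rewrite subr_gt0.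
    have [n _ /(_ n (leqnn n)) /= ne] := near_infty_natSinv_lt (PosNum d0).
    by exists n => //; split => //=; rewrite in_itv /= andbT -ltrBrDl.
  - move=> n; have /(inf_adherent)/(_ (conj B0 Blb))[b Bb sb] : 0 < n.+1%:R^-1 :> R by [].
    apply: le_trans (left_approx _ Bb); rewrite addeC.
    apply: leeD2l; apply: le_measure; rewrite ?inE; [exact: measurableI..|].
    move=> t [Bt] /=; rewrite in_itv /= andbT => ts; split => //=.
    by rewrite in_itv /= andbT; apply: lt_trans ts.
pose F n := B `&` `]- n%:R, +oo[.
apply: (@measure_approx_le _ F 0) => //.
- by move=> n; apply: measurableI.
- move=> m n mn; apply/subsetPset => t [Bt] /=; rewrite !in_itv /= !andbT.
  move=> tn; split => //=; rewrite in_itv /= andbT; apply: le_lt_trans tn.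
  by rewrite lerN2 ler_nat.
- move=> t Bt; left; exists (Num.truncn `|t|).+1 => //; split => //=.
  rewrite in_itv /= andbT ltrNl (le_lt_trans (ler_norm (- t)))// normrN.
  by have /andP[] := truncn_itv (normr_ge0 t).
- move=> n; have [b Bb nb] := Bnlb (- n%:R).
  apply: le_trans (left_approx _ Bb); rewrite addeC.
  apply: leeD2l; apply: le_measure; rewrite ?inE; [exact: measurableI..|].
  move=> t [Bt] /=; rewrite in_itv /= andbT => ts; split => //=.
  by rewrite in_itv /= andbT; apply: lt_trans ts.
Qed.

End Lebesgue1D.

(** * Prekopa-Leindler on the line and for fields *)

Section PrekopaLeindler1D.
Variable R : realType.
Local Notation leb := (@lebesgue_measure R).
Local Open Scope ereal_scope.
Implicit Types f g h : measurableTypeR R -> \bar R.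

Definition subgraph f : set (measurableTypeR R * measurableTypeR R) :=
  [set p | (0 <= p.2)%R /\ p.2%:E < f p.1].

Lemma measurable_subgraph f : measurable_fun setT f -> measurable (subgraph f).
Proof.
move=> mf.
have -> : subgraph f = [set p | (0 <= p.2)%R] `&` [set p | p.2%:E < f p.1] by [].
apply: measurableI.
  rewrite -[X in measurable X]setTI.
  rewrite (_ : [set p | _] = (fun p : measurableTypeR R * measurableTypeR R => p.2) @^-1` `[0%R, +oo[%classic).
    by apply: measurable_snd.
  by apply/seteqP; split => p /=; rewrite in_itv /= andbT.
rewrite -[X in measurable X]setTI; apply: measurable_lte => //.
  by apply/measurable_EFinP; exact: measurable_snd.
by apply: measurableT_comp => //; exact: measurable_fst.
Qed.

Lemma ysection_subgraph f r :
  ysection (subgraph f) r = [set t | (0 <= r)%R /\ r%:E < f t].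
Proof. by apply/seteqP; split => t; rewrite ysectionE. Qed.

Lemma layer_cake f : measurable_fun setT f -> (forall t, 0 <= f t) ->
  \int[leb]_t f t = \int[leb]_r leb (ysection (subgraph f) r).
Proof.
move=> mf f0; have mS := measurable_subgraph mf.
have FE := indic_fubini_tonelli_FE leb mS.
have GE := indic_fubini_tonelli_GE leb mS.
have := indic_fubini_tonelli leb leb mS; rewrite FE GE => <-.
apply: eq_integral => t _ /=.
have -> : xsection (subgraph f) t = [set r | (0 <= r)%R /\ r%:E < f t].
  by apply/seteqP; split => r; rewrite xsectionE.
case: (f t) (f0 t) => [y y0|_|//]; last first.
  rewrite (_ : [set _ | _] = `[0%R, +oo[%classic); first by rewrite lebesgue_measure_itv /= ltry.
  by apply/seteqP; split => r /=; rewrite in_itv /= andbT ?ltry; [case|].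
rewrite (_ : [set _ | _] = `[0%R, y[%classic).
  rewrite lebesgue_measure_itv/= lte_fin; case: ltgtP y0; rewrite ?lee_fin //.
  - by rewrite sube0.
  - by move=> y0; rewrite leNgt y0.
  - by move=> <-.
by apply/seteqP; split => r /=; rewrite in_itv /= lte_fin => /andP.
Qed.

(** When f and g have the same supremum m, their level sets at a height r < m
    are both nonempty, so Brunn-Minkowski applies to them; above m both are
    empty.  Integrate over r. *)
Lemma prekopa_leindler_normalized (m : R) f g h :
  measurable_fun setT f -> measurable_fun setT g -> measurable_fun setT h ->
  (forall t, 0 <= f t) -> (forall t, 0 <= g t) -> (forall t, 0 <= h t) ->
  (forall t, f t <= m%:E) -> (forall r : R, (r < m)%R -> exists t, r%:E < f t) ->
  (forall t, g t <= m%:E) -> (forall r : R, (r < m)%R -> exists t, r%:E < g t) ->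
  (forall s t, f s * g t <= h ((s + t) / 2)%R ^+ 2) ->
  \int[leb]_t f t + \int[leb]_t g t <= 2%:E * \int[leb]_t h t.
Proof.
move=> mf mg mh f0 g0 h0 fm fr gm gr fgh.
have mtail k : measurable_fun setT k ->
    measurable_fun setT (fun r => leb (ysection (subgraph k) r)).
  by move=> mk; apply: measurable_fun_ysection; exact: measurable_subgraph.
rewrite (layer_cake mf f0) (layer_cake mg g0) (layer_cake mh h0).
rewrite -ge0_integralD//; try exact: mtail.
rewrite -ge0_integralZl//; try exact: mtail.
apply: ge0_le_integral => //.
- by move=> r _; apply: adde_ge0.
- by apply: emeasurable_funD; exact: mtail.
- by apply: measurable_funeM; exact: mtail.
move=> r _ /=.
have [/andP[r0 rm]|rout] := boolP (0 <= r < m)%R; last first.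
  have empty (k : measurableTypeR R -> \bar R) : (forall t, k t <= m%:E) -> ysection (subgraph k) r = set0.
    move=> km; rewrite ysection_subgraph -subset0 => t [r0 rt].
    by move: rout; rewrite r0 -lte_fin (lt_le_trans rt).
  by rewrite (empty f fm) (empty g gm) measure0 adde0 mule_ge0.
apply: brunn_minkowski1; try by (apply: measurable_ysection; exact: measurable_subgraph).
- move=> s t; rewrite !ysection_subgraph => -[_ rs] [_ rt]; split => //.
  rewrite ltNge; apply/negP => hr; have := fgh s t; apply/negP; rewrite -ltNge.
  apply: (@le_lt_trans _ _ (r%:E ^+ 2)).
    by rewrite !expe2; apply: lee_pmul.
  rewrite expe2; have [->|rn0] := eqVneq r 0%R.
    by rewrite mule0; apply: mule_gt0; [exact: le_lt_trans rs|exact: le_lt_trans rt].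
  have rp : 0 < r%:E by rewrite lte_fin lt_neqAle eq_sym rn0.
  apply: (@lt_le_trans _ _ (f s * r%:E)).
    by rewrite lte_pmul2r.
  by apply: lee_wpmul2l => //; exact: ltW.
- by have [t rt] := fr _ rm; exists t; rewrite ysection_subgraph.
- by have [t rt] := gr _ rm; exists t; rewrite ysection_subgraph.
Qed.


Lemma ereal_amgm (c : R) (x y z : \bar R) : (0 < c)%R -> 0 <= x -> 0 <= y -> 0 <= z ->
  c%:E * x + c^-1%:E * y <= 2%:E * z -> x * y <= z ^+ 2.
Proof.
move=> c0; case: z => [z|_ _ _ _|//]; last by rewrite expe2 mulyy leey.
have notoo (w : \bar R) : 0 <= w -> (+oo + w <= 2%:E * z%:E) = false.
  by case: w.
case: x => [x|_ y0 _|//]; last first.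
  by rewrite gt0_muley ?lte_fin// notoo// mule_ge0// lee_fin invr_ge0 ltW.
case: y => [y|x0 _ _|//]; last first.
  by rewrite (gt0_muley (x := c^-1%:E)) ?lte_fin ?invr_gt0// addeC notoo// mule_ge0// lee_fin ltW.
rewrite expe2 -!EFinM -EFinD !lee_fin => x0 y0 z0 h.
have ci : (c * c^-1 = 1)%R by rewrite divff// gt_eqF.
have h2 : ((c * x + c^-1 * y) ^+ 2 <= (2 * z) ^+ 2)%R.
  by rewrite ler_pXn2r// ?nnegrE ?addr_ge0 ?mulr_ge0// ?invr_ge0 ltW.
have h3 : (0 <= (c * x - c^-1 * y) ^+ 2)%R by exact: sqr_ge0.
have e : ((c * x + c^-1 * y) ^+ 2 = (c * x - c^-1 * y) ^+ 2 + 4 * (c * c^-1) * (x * y))%R.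
  ring.
by move: h2; rewrite e ci; nra.
Qed.

Lemma ereal_sup_mule_le (A : set (\bar R)) (K M : \bar R) : 0 <= K -> 0 <= M ->
  (forall a, A a -> 0 <= a) -> A !=set0 ->
  (forall a, A a -> a * K <= M) -> ereal_sup A * K <= M.
Proof.
move=> K0 M0 A0 [b Ab] AM.
have s0 : 0 <= ereal_sup A by apply: le_trans (ereal_sup_ubound Ab); exact: A0.
have [K0'|] := eqVneq K 0; first by rewrite K0' mule0.
case: K K0 AM => [k| |//] k0 AM kn0; last first.
  have [s0'|sp] := eqVneq (ereal_sup A) 0; first by rewrite s0' mul0e.
  have : 0 < ereal_sup A by rewrite lt_neqAle eq_sym sp.
  move=> /ereal_sup_gt[a Aa a0].
  by have := AM a Aa; rewrite gt0_muley// leye_eq => /eqP ->; rewrite leey.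
have kp : (0 < k)%R by rewrite lt_neqAle eq_sym -lee_fin k0 andbT; move: kn0; rewrite eqe.
rewrite -lee_pdivlMr//; apply: ge_ereal_sup => a Aa.
by rewrite lee_pdivlMr//; exact: AM.
Qed.

(** The hypothesis is invariant under f -> c f, g -> g / c.  Choose c to equalize
    the two suprema, then pass from the arithmetic to the geometric mean. *)
Lemma prekopa_leindler_bounded f g h (b1 b2 : R) :
  measurable_fun setT f -> measurable_fun setT g -> measurable_fun setT h ->
  (forall t, 0 <= f t) -> (forall t, 0 <= g t) -> (forall t, 0 <= h t) ->
  (forall t, f t <= b1%:E) -> (forall t, g t <= b2%:E) ->
  (forall s t, f s * g t <= h ((s + t) / 2)%R ^+ 2) ->
  (\int[leb]_t f t) * (\int[leb]_t g t) <= (\int[leb]_t h t) ^+ 2.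
Proof.
move=> mf mg mh f0 g0 h0 fb gb fgh.
have If : 0 <= \int[leb]_t f t by apply: integral_ge0.
have Ig : 0 <= \int[leb]_t g t by apply: integral_ge0.
have Ih : 0 <= \int[leb]_t h t by apply: integral_ge0.
have Ih2 : 0 <= (\int[leb]_t h t) ^+ 2 by rewrite expe2 mule_ge0.
have sup_cases (k : measurableTypeR R -> \bar R) b : (forall t, 0 <= k t) -> (forall t, k t <= b%:E) ->
    (forall t, k t = 0) \/ exists2 a : R, (0 < a)%R & ereal_sup (range k) = a%:E.
  move=> k0 kb; have sb : ereal_sup (range k) <= b%:E.
    by apply: ge_ereal_sup => _ [t _ <-].
  have s0 : 0 <= ereal_sup (range k).
    by apply: (le_trans (k0 0%R)); apply: ereal_sup_ubound; exists 0%R.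
  have [s0'|sp] := eqVneq (ereal_sup (range k)) 0.
    left=> t; apply/eqP; rewrite eq_le k0 andbT -s0'.
    by apply: ereal_sup_ubound; exists t.
  right; case: (ereal_sup (range k)) s0 sp sb => [a| |]//.
  rewrite lee_fin eqe => a0 an0 _; exists a => //.
  by rewrite lt_neqAle eq_sym an0.
have [f0'|[a a0 fa]] := sup_cases f b1 f0 fb.
  by rewrite integral0_eq ?mul0e.
have [g0'|[b b0 gb']] := sup_cases g b2 g0 gb.
  by rewrite [X in _ * X]integral0_eq ?mule0.
pose c := Num.sqrt (b / a).
have c0 : (0 < c)%R by rewrite sqrtr_gt0 divr_gt0.
have cI0 : (0 < c^-1)%R by rewrite invr_gt0.
have cc : (c * c * a = b)%R by rewrite -expr2 sqr_sqrtr ?ltW ?divr_gt0// divfK ?gt_eqF.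
pose m := (c * a)%R.
have mE : m = (c^-1 * b)%R by rewrite -cc /m; field; rewrite gt_eqF.
apply: (@ereal_amgm c) => //.
rewrite -ge0_integralZl ?lee_fin ?(ltW c0)// -ge0_integralZl ?lee_fin ?(ltW cI0)//.
have scaled (k : measurableTypeR R -> \bar R) (d e : R) : (0 < d)%R -> ereal_sup (range k) = e%:E ->
   (forall t, d%:E * k t <= (d * e)%:E) /\
   (forall r : R, (r < d * e)%R -> exists t, r%:E < d%:E * k t).
  move=> d0 ke; split => [t|r rde].
    rewrite EFinM; apply: lee_wpmul2l; first by rewrite lee_fin ltW.
    by rewrite -ke; apply: ereal_sup_ubound; exists t.
  have : (r / d)%:E < ereal_sup (range k) by rewrite ke lte_fin ltr_pdivrMr// mulrC.
  move=> /ereal_sup_gt[_ [t _ <-] rt]; exists t.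
  by rewrite -lte_pdivrMl// -EFinM mulrC.
have [fm fr] := scaled f c a c0 fa.
have [gm gr] := scaled g c^-1%R b cI0 gb'.
rewrite -mE in gm gr.
apply: (prekopa_leindler_normalized (m := m)) => //.
- exact: measurable_funeM.
- exact: measurable_funeM.
- by move=> t; rewrite mule_ge0// lee_fin ltW.
- by move=> t; rewrite mule_ge0// lee_fin ltW.
move=> s t; rewrite muleACA -EFinM divff ?gt_eqF// mul1e; exact: fgh.
Qed.


(** The integral is a supremum over bounded simple functions. *)
Lemma prekopa_leindler1 f g h :
  measurable_fun setT f -> measurable_fun setT g -> measurable_fun setT h ->
  (forall t, 0 <= f t) -> (forall t, 0 <= g t) -> (forall t, 0 <= h t) ->
  (forall s t, f s * g t <= h ((s + t) / 2)%R ^+ 2) ->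
  (\int[leb]_t f t) * (\int[leb]_t g t) <= (\int[leb]_t h t) ^+ 2.
Proof.
move=> mf mg mh f0 g0 h0 fgh.
have Ig : 0 <= \int[leb]_t g t by apply: integral_ge0.
have Ih2 : 0 <= (\int[leb]_t h t) ^+ 2.
  by rewrite expe2 mule_ge0//; apply: integral_ge0.
rewrite [X in X * _]ge0_integralTE//.
apply: ereal_sup_mule_le => //.
- by move=> _ [p _ <-]; exact: sintegral_ge0.
- by eexists; exists nnsfun0 => //= t.
move=> _ [p /= pf <-]; rewrite muleC ge0_integralTE//.
apply: ereal_sup_mule_le => //.
- exact: sintegral_ge0.
- by move=> _ [q _ <-]; exact: sintegral_ge0.
- by eexists; exists nnsfun0 => //= t.
move=> _ [q /= qg <-].
have bnd (k : {nnsfun measurableTypeR R >-> R}) : exists b, forall t, (k t <= b)%R.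
  have [b [_ kb]] := simple_bounded k.
  exists (b + 1)%R => t; apply: (le_trans (ler_norm _)).
  by apply: (kb _ _ t) => //; rewrite ltrDl.
have [b1 pb] := bnd p; have [b2 qb] := bnd q.
have sE (k : {nnsfun measurableTypeR R >-> R}) : sintegral leb k = \int[leb]_t (k t)%:E.
  by rewrite integral_nnsfun// patch_setT.
rewrite muleC !sE; apply: (@prekopa_leindler_bounded _ _ _ b1 b2) => //.
- exact/measurable_EFinP.
- exact/measurable_EFinP.
- by move=> t; rewrite lee_fin.
- by move=> t; rewrite lee_fin.
move=> s t; apply: le_trans (fgh s t).
by apply: lee_pmul; rewrite ?lee_fin.
Qed.

End PrekopaLeindler1D.

Section PrekopaLeindlerFields.
Variables (R : realType) (d : nat).
Local Notation field := (field R d).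
Local Notation leb := (@lebesgue_measure R).
Local Open Scope ereal_scope.

(** Tonelli's theorem with an arbitrary measure on the left: by definition
    [m1 \x m2] integrates against m1 the m2-measure of the sections.  The
    reference measures on fields enter as m1. *)
Lemma tonelli_left d1 d2 (T1 : measurableType d1) (T2 : measurableType d2)
    (m1 : {measure set T1 -> \bar R}) (m2 : {sigma_finite_measure set T2 -> \bar R})
    (f : T1 * T2 -> \bar R) :
  measurable_fun setT f -> (forall p, 0 <= f p) ->
  \int[m1 \x m2]_p f p = \int[m1]_x \int[m2]_y f (x, y).
Proof.
move=> mf f0; pose p := nnsfun_approx measurableT mf.
have approx z : (EFin \o p ^~ z) @ \oo --> f z by exact: cvg_nnsfun_approx.
have limE z : limn (EFin \o p ^~ z) = f z by apply/cvg_lim.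
have mono z : {homo (fun n => (p n z)%:E) : i j / (i <= j)%N >-> i <= j}.
  by move=> i j ij; rewrite lee_fin; exact/lefP/nd_nnsfun_approx.
have simple n : \int[m1 \x m2]_z (p n z)%:E = \int[m1]_x fubini_F m2 (EFin \o p n) x.
  rewrite integral_nnsfun// patch_setT sfun_fubini_tonelli_FE sintegralE.
  rewrite ge0_integral_fsum//; last 2 first.
  - by move=> r; apply: measurable_funeM; exact: measurable_fun_xsection.
  - move=> r x _; have [r0|r0] := leP 0%R r; first by rewrite mule_ge0.
    by rewrite preimage_nnfun0// xsection0 measure0 mule0.
  apply: eq_fsbigr => r; rewrite inE => -[z _ <-].
  rewrite ge0_integralZl ?lee_fin//.
  exact: measurable_fun_xsection.
have mp n : measurable_fun setT (EFin \o p n) by exact/measurable_EFinP.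
have p0 n z : 0 <= (p n z)%:E by rewrite lee_fin.
have inner x : limn (fun n => fubini_F m2 (EFin \o p n) x) = \int[m2]_y f (x, y).
  rewrite /fubini_F -(monotone_convergence m2 measurableT (g' := fun n y => (p n (x, y))%:E)).
  - by apply: eq_integral => y _; exact: limE.
  - by move=> n; apply: (measurableT_comp (mp n)); exact: measurable_pair1.
  - by move=> n y _; exact: p0.
  - by move=> y _; exact: mono.
transitivity (limn (fun n => \int[m1 \x m2]_z (p n z)%:E)).
  rewrite -(monotone_convergence _ measurableT (g' := fun n z => (p n z)%:E)).
  - by apply: eq_integral => z _; rewrite -limE.
  - exact: mp.
  - by move=> n z _; exact: p0.
  - by move=> z _; exact: mono.
rewrite (_ : (fun n => _) = fun n => \int[m1]_x fubini_F m2 (EFin \o p n) x); last first.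
  by apply/funext => n; exact: simple.
rewrite -(monotone_convergence m1 measurableT (g' := fun n => fubini_F m2 (EFin \o p n))).
- by apply: eq_integral => x _; exact: inner.
- by move=> n; exact: sfun_measurable_fun_fubini_tonelli_F.
- by move=> n x _; apply: integral_ge0 => y _; exact: p0.
move=> x _ i j ij; apply: ge0_le_integral => //.
- by move=> y _; exact: p0.
- by apply: (measurableT_comp (mp i)); exact: measurable_pair1.
- by apply: (measurableT_comp (mp j)); exact: measurable_pair1.
- by move=> y _; exact: mono.
Qed.

Definition midpoint (phi psi : field) : field := fun z => ((phi z + psi z) / 2)%R.

Lemma integral_lebesgue_add (m : {measure set field -> \bar R}) x (f : field -> \bar R) :
  measurable_fun setT f -> (forall phi, 0 <= f phi) ->
  \int[lebesgue_add m x]_phi f phi =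
  \int[m]_phi \int[leb]_t f (update x (phi, t)).
Proof.
move=> mf f0.
have mup : measurable_fun setT
    (update x : field * measurableTypeR R -> field) := @measurable_update R d x.
have := ge0_integral_pushforward mup (m \x leb) measurableT mf (fun phi _ => f0 phi).
rewrite preimage_setT => /= ->; rewrite tonelli_left//.
by apply: measurableT_comp => //; exact: measurable_update.
Qed.

(** One coordinate is integrated out at a time: the one-dimensional inequality
    turns the pointwise hypothesis on s into the same hypothesis for the partial
    integrals.  It is imposed only on fields vanishing off s, because that is
    where the measure sits and where convexity of the Hamiltonian holds. *)
Lemma prekopa_leindler (s : seq (site d)) (f g h : field -> \bar R) :
  measurable_fun setT f -> measurable_fun setT g -> measurable_fun setT h ->
  (forall phi, 0 <= f phi) -> (forall phi, 0 <= g phi) -> (forall phi, 0 <= h phi) ->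
  (forall phi psi : field, (forall z, z \notin s -> phi z = 0%R) ->
     (forall z, z \notin s -> psi z = 0%R) ->
     f phi * g psi <= h (midpoint phi psi) ^+ 2) ->
  (\int[lebesgue_seq (fun=> 0%R) s]_phi f phi)
  * (\int[lebesgue_seq (fun=> 0%R) s]_phi g phi)
  <= (\int[lebesgue_seq (fun=> 0%R) s]_phi h phi) ^+ 2.
Proof.
elim: s f g h => [|x s IH] f g h mf mg mh f0 g0 h0 fgh /=.
  rewrite !integral_dirac// !diracT !mul1e.
  apply: le_trans (fgh _ _ _ _) _ => //.
  rewrite (_ : midpoint _ _ = fun=> 0%R)//.
  by apply/funext => z; rewrite /midpoint addr0 mul0r.
have mup (k : field -> \bar R) : measurable_fun setT k ->
    measurable_fun setT (fun p : field * measurableTypeR R => k (update x p)).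
  by move=> mk; apply: measurableT_comp => //; exact: measurable_update.
have mup1 (k : field -> \bar R) phi : measurable_fun setT k ->
    measurable_fun setT (fun t : measurableTypeR R => k (update x (phi, t))).
  by move=> mk; apply: (measurableT_comp (mup _ mk)); exact: measurable_pair1.
rewrite (integral_lebesgue_add _ x mf f0) (integral_lebesgue_add _ x mg g0).
rewrite (integral_lebesgue_add _ x mh h0); apply: IH.
- exact: (measurable_fun_fubini_tonelli_F (m2 := leb) _ (mup _ mf) (fun p => f0 _)).
- exact: (measurable_fun_fubini_tonelli_F (m2 := leb) _ (mup _ mg) (fun p => g0 _)).
- exact: (measurable_fun_fubini_tonelli_F (m2 := leb) _ (mup _ mh) (fun p => h0 _)).
- by move=> phi; apply: integral_ge0 => t _; exact: f0.
- by move=> phi; apply: integral_ge0 => t _; exact: g0.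
- by move=> phi; apply: integral_ge0 => t _; exact: h0.
move=> phi psi phi0 psi0; apply: prekopa_leindler1 => //; try exact: mup1.
move=> a b; rewrite (_ : update x (midpoint phi psi, _) =
  midpoint (update x (phi, a)) (update x (psi, b))).
  apply: fgh => z; rewrite inE negb_or /update => /andP[/negbTE ->] zs /=.
    exact: phi0.
  exact: psi0.
by apply/funext => z; rewrite /update /midpoint /=; case: eqP.
Qed.

End PrekopaLeindlerFields.

(** * Differentiation along lines *)

Section Calculus.
Variable R : realType.

Lemma mean_value (g dg : R -> R) (a b : R) :
  (forall x : R, is_derive x (1 : R) g (dg x)) -> a < b ->
  exists2 c, a < c < b & g b - g a = dg c * (b - a).
Proof.
move=> gd ab; have gc : {within `[a, b], continuous g}.
  by apply: derivable_within_continuous => x _; have [] := gd x.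
have [c] := MVT ab (fun x _ => gd x) gc.
by rewrite in_itv /=; exists c.
Qed.

Lemma mean_value_sym (g dg : R -> R) (a b : R) :
  (forall x : R, is_derive x (1 : R) g (dg x)) ->
  exists2 c, `|c - a| <= `|b - a| & g b - g a = dg c * (b - a).
Proof.
move=> gd; case: (ltgtP a b) => [ab|ba|<-]; last by exists a; rewrite ?subrr ?mulr0.
  have [c /andP[ac cb] e] := mean_value gd ab; exists c => //.
  by rewrite !ger0_norm ?subr_ge0 ?(ltW ac) ?(ltW ab)//; lra.
have [c /andP[bc ca] e] := mean_value gd ba; exists c.
  by rewrite !ler0_norm ?subr_le0 ?(ltW ca) ?(ltW ba)//; lra.
by rewrite -opprB e -mulrN opprB.
Qed.

(** Subtracting K t^2/2 reduces this to convexity, i.e. to the mean value theorem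
    used on [0, 1], on [-1, 0] and on p'. *)
Lemma second_difference_ge (p p1 p2 : R -> R) (K : R) :
  (forall t : R, is_derive t (1 : R) p (p1 t)) -> (forall t : R, is_derive t (1 : R) p1 (p2 t)) ->
  (forall t, K <= p2 t) -> K <= p 1 + p (-1) - 2 * p 0.
Proof.
move=> dp dp1 Kp2.
pose q t := p t - K / 2 * (t * t); pose q1 t := p1 t - K * t.
have dq (t : R) : is_derive t (1 : R) q (q1 t).
  have -> : q1 t = p1 t - K / 2 *: (t *: 1 + t *: 1 : R).
    by rewrite /q1 ![_ *: 1]mulr1 -[_ *: _]/(_ * _); field.
  by apply: is_deriveB; apply: is_deriveZ; exact: is_deriveM.
have dq1 (t : R) : is_derive t (1 : R) q1 (p2 t - K).
  have -> : p2 t - K = p2 t - K *: (1 : R) by rewrite [_ *: 1]mulr1.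
  by apply: is_deriveB; apply: is_deriveZ.
have [c1 /andP[c10 c11] e1] := mean_value dq (@ltr01 R).
have [c2 /andP[c2m c20] e2] := mean_value dq (ltrN10 R).
have [c3 _ e3] := mean_value dq1 (lt_trans c20 c10).
have := Kp2 c3; rewrite -subr_ge0 => h.
have : 0 <= (p2 c3 - K) * (c1 - c2) by rewrite mulr_ge0// subr_ge0 ltW// (lt_trans c20).
by rewrite -e3; move: e1 e2; rewrite /q; lra.
Qed.

Variable k : nat.
Implicit Types (f : 'rV[R]_k -> R) (eta v : 'rV[R]_k).

Lemma is_derive_line f eta v (t df : R) :
  is_derive (eta + t *: v) v f df -> is_derive t (1 : R) (fun s => f (eta + s *: v)) df.
Proof.
have E : (fun h : R => h^-1 *: ((f \o shift (eta + t *: v)) (h *: v) - f (eta + t *: v))) =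
  (fun h : R => h^-1 *: (((fun s => f (eta + s *: v)) \o shift t) (h *: 1) -
     (fun s => f (eta + s *: v)) t)).
  apply/funext => h /=; congr (_ *: (f _ - _)).
  by rewrite scalerDl addrCA [h *: 1]mulr1.
move=> [d1 d2]; split; first by move: d1; rewrite /derivable E.
by move: d2; rewrite /derive E.
Qed.

(** The increment along e is taken from a base point that itself moves with h;
    the mean value theorem and the continuity of the partial derivative absorb
    the displacement. *)
Lemma C1_increment f (pd : 'rV[R]_k -> R) (e eta v : 'rV[R]_k) (c : R) :
  (forall x, is_derive x e f (pd x)) -> {for eta, continuous pd} ->
  h^-1 *: (f (h *: v + (h * c) *: e + eta) - f (h *: v + eta)) @[h --> 0^']
    --> c * pd eta.
Proof.
move=> fd pdc.
have inc h : h != 0 -> exists2 y, `|y - eta| <= `|h| * (`|v| + `|c| * `|e|) &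
    h^-1 *: (f (h *: v + (h * c) *: e + eta) - f (h *: v + eta)) = c * pd y.
  move=> h0; pose z := h *: v + eta.
  have gd t : is_derive t (1 : R) (fun s => f (z + s *: e)) (pd (z + t *: e)).
    exact: is_derive_line.
  have [s] := mean_value_sym 0 (h * c) gd; rewrite !subr0 scale0r addr0 => sh E.
  exists (z + s *: e); last first.
    rewrite (_ : h *: v + _ + eta = z + (h * c) *: e); last by rewrite addrAC.
    rewrite E -[_ *: _]/(h^-1 * _) mulrCA; field.
    exact: h0.
  rewrite /z addrAC addrK (le_trans (ler_normD _ _))// !normrZ mulrDr lerD2l mulrA.
  by rewrite ler_wpM2r// -normrM.
apply/cvgrPdist_lt => eps eps0.
have e1 : 0 < eps / (`|c| + 1) by rewrite divr_gt0// ltr_wpDl.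
have /cvgrPdist_lt/(_ _ e1) : pd y @[y --> eta] --> pd eta by exact: pdc.
move=> /nbhs_ballP[del /= del0 B].
pose r := `|v| + `|c| * `|e| + 1.
have r0 : 0 < r by rewrite ltr_wpDl// addr_ge0// mulr_ge0.
near=> h.
have h0 : h != 0 by near: h; exact: nbhs_dnbhs_neq.
have [y yB ->] := inc h h0.
have hdel : `|h| < del / r.
  near: h; apply: dnbhs0_lt; exact: divr_gt0.
have : ball eta del y.
  rewrite -ball_normE /= distrC (le_lt_trans yB)//.
  apply: (@le_lt_trans _ _ (`|h| * r)); first by rewrite ler_wpM2l// lerDl.
  by rewrite -ltr_pdivlMr.
move=> /B /= yeps; rewrite -mulrBr normrM.
apply: (@le_lt_trans _ _ ((`|c| + 1) * `|pd eta - pd y|)).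
  by rewrite ler_wpM2r// lerDl.
by rewrite mulrC -ltr_pdivlMr// ltr_wpDl.
Unshelve. all: by end_near.
Qed.

(** A direction is reached one coordinate at a time, each contributing its own
    increment. *)
Lemma C1_is_derive f : (forall i x, derivable f x (delta_mx ord0 i)) ->
  (forall i, continuous (pderiv i f)) ->
  forall eta v, is_derive eta v f (\sum_i v ord0 i * pderiv i f eta).
Proof.
move=> fd fc eta v; pose vJ (J : seq 'I_k) : 'rV[R]_k := \sum_(i <- J) v ord0 i *: delta_mx ord0 i.
rewrite {1}(_ : v = vJ (index_enum 'I_k)); last first.
  by rewrite {1}[v]matrix_sum_delta big_ord1.
have partialE i x : is_derive x (delta_mx ord0 i) f (pderiv i f x).
  by split; [exact: fd|].
have cv : forall J, h^-1 *: ((f \o shift eta) (h *: vJ J) - f eta) @[h --> 0^']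
    --> \sum_(i <- J) v ord0 i * pderiv i f eta.
  elim=> [|i J IH].
    rewrite big_nil (_ : (fun _ => _) = fun=> 0); first exact: cvg_cst.
    by apply/funext => h; rewrite /vJ big_nil scaler0 /= add0r subrr scaler0.
  rewrite big_cons; have C := @C1_increment f _ _ eta (vJ J) (v ord0 i) (partialE i) (@fc i eta).
  rewrite (_ : (fun _ => _) = (fun h => h^-1 *: (f (h *: vJ J + (h * v ord0 i) *: delta_mx ord0 i + eta) - f (h *: vJ J + eta))
     + h^-1 *: ((f \o shift eta) (h *: vJ J) - f eta))).
    exact: cvgD.
  apply/funext => h /=; rewrite -scalerDr addrA subrK; congr (_ *: (f _ - _)).
  by rewrite /vJ big_cons scalerDr scalerA [X in X + eta]addrC.
split; first by apply/cvg_ex; eexists; exact: cv.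
by apply/cvg_lim => //; exact: cv.
Qed.

End Calculus.

(** * The Hessian of the Hamiltonian *)

Section Bilinear.
Variable R : realFieldType.

(** Expand the square on the right: the terms in u_x^2 and u_y^2 vanish by the
    row and the column sums respectively. *)
Lemma laplacian_form (T : eqType) (W : seq T) (q : T -> T -> R) (u : T -> R) :
  {in W, forall x, \sum_(y <- W) q x y = 0} ->
  {in W, forall y, \sum_(x <- W) q x y = 0} ->
  \sum_(x <- W) \sum_(y <- W) u x * u y * q x y =
  2^-1 * \sum_(x <- W) \sum_(y <- W) (- q x y) * (u x - u y) ^+ 2.
Proof.
move=> q1 q2.
have s1 : \sum_(x <- W) \sum_(y <- W) u x ^+ 2 * q x y = 0.
  by rewrite big_seq big1// => x xW; rewrite -mulr_sumr q1// mulr0.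
have s2 : \sum_(x <- W) \sum_(y <- W) u y ^+ 2 * q x y = 0.
  by rewrite exchange_big big_seq big1// => y yW; rewrite -mulr_sumr q2// mulr0.
have E : \sum_(x <- W) \sum_(y <- W) (- q x y) * (u x - u y) ^+ 2 =
  2 * (\sum_(x <- W) \sum_(y <- W) u x * u y * q x y)
  - \sum_(x <- W) \sum_(y <- W) u x ^+ 2 * q x y
  - \sum_(x <- W) \sum_(y <- W) u y ^+ 2 * q x y.
  rewrite mulr_sumr -!sumrB; apply: eq_bigr => x1 _.
  by rewrite mulr_sumr -!sumrB; apply: eq_bigr => y _; ring.
by rewrite [X in 2^-1 * X]E s1 s2 !subr0 mulKf.
Qed.

Definition bilinear k (h : 'I_k -> 'I_k -> R) (a b : 'rV[R]_k) : R :=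
  \sum_i \sum_j a ord0 i * b ord0 j * h i j.

Lemma bilinear_sum k (h : 'I_k -> 'I_k -> R) (T1 T2 : Type) (W1 : seq T1) (W2 : seq T2)
    (u : T1 -> R) (w : T2 -> R) (a : T1 -> 'rV[R]_k) (b : T2 -> 'rV[R]_k) :
  bilinear h (\sum_(x <- W1) u x *: a x) (\sum_(y <- W2) w y *: b y) =
  \sum_(x <- W1) \sum_(y <- W2) u x * w y * bilinear h (a x) (b y).
Proof.
rewrite /bilinear; under [RHS]eq_bigr do under eq_bigr do rewrite mulr_sumr.
under [RHS]eq_bigr do rewrite exchange_big /=.
rewrite [RHS]exchange_big /=; apply: eq_bigr => i _.
under [RHS]eq_bigr do under eq_bigr do rewrite mulr_sumr.
under [RHS]eq_bigr do rewrite exchange_big /=.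
rewrite [RHS]exchange_big /=; apply: eq_bigr => j _.
rewrite !summxE mulr_suml mulr_suml; apply: eq_bigr => x _.
rewrite mulr_sumr mulr_suml; apply: eq_bigr => y _.
by rewrite !mxE; ring.
Qed.

End Bilinear.

Lemma is_derive_sum_fun (R : realType) (I : Type) (r : seq I) (h dh : I -> R -> R) (t : R) :
  (forall i, is_derive t (1 : R) (h i) (dh i t)) ->
  is_derive t (1 : R) (fun s => \sum_(i <- r) h i s) (\sum_(i <- r) dh i t).
Proof.
move=> hd; elim: r => [|i r IH].
  rewrite big_nil (_ : (fun _ => _) = cst 0); first exact: is_derive_cst.
  by apply/funext => s; rewrite big_nil.
rewrite big_cons (_ : (fun _ => _) = (h i) + (fun s => \sum_(i <- r) h i s)).
  exact: is_deriveD.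
by apply/funext => s; rewrite big_cons.
Qed.

Section Hessian.
Variables (R : realType) (d : nat) (Gam : {fset site d}) (c0 alpha : R).
Variable V : potential Gam c0 alpha.
Local Notation field := (field R d).
Local Notation k := #|` Gam|.

Definition spike (x : site d) : field := fun z => (z == x)%:R.

Definition line (phi u : field) (t : R) : field := fun z => phi z + t * u z.

Lemma star_gradientE z (phi : field) i :
  star_gradient Gam z phi ord0 i = phi (z + step i) - phi z.
Proof. by rewrite mxE. Qed.

Lemma star_gradient_line z phi u t : star_gradient Gam z (line phi u t) =
  star_gradient Gam z phi + t *: star_gradient Gam z u.
Proof. by apply/rowP => i; rewrite !mxE /nabla /line /=; ring. Qed.

Lemma bump_line x t phi : bump_at x t phi = line phi (spike x) t.
Proof.
apply/funext => z; rewrite /bump_at /line /spike.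
by case: eqP; rewrite ?mulr1 ?mulr0 ?addr0.
Qed.

Definition hessian z eta : 'rV[R]_k -> 'rV[R]_k -> R :=
  bilinear (fun i j => pderiv j (pderiv i (V z)) eta).

Lemma is_derive_pot z (eta a : 'rV[R]_k) (t : R) : is_derive t (1 : R)
  (fun s => V z (eta + s *: a)) (\sum_i a ord0 i * pderiv i (V z) (eta + t *: a)).
Proof.
by apply: is_derive_line; apply: C1_is_derive; have [_ ? _ [? _] _] := pot_smooth V z.
Qed.

Lemma is_derive_pderiv_pot z (eta a b : 'rV[R]_k) (t : R) : is_derive t (1 : R)
  (fun s => \sum_i a ord0 i * pderiv i (V z) (eta + s *: b))
  (hessian z (eta + t *: b) a b).
Proof.
rewrite /hessian /bilinear.
apply: (@is_derive_sum_fun R _ _ (fun i s => a ord0 i * pderiv i (V z) (eta + s *: b))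
  (fun i s => \sum_j a ord0 i * b ord0 j * pderiv j (pderiv i (V z)) (eta + s *: b))).
move=> i; under eq_bigr do rewrite -mulrA.
rewrite -mulr_sumr; apply: is_deriveZ; apply: is_derive_line.
by apply: C1_is_derive; have [_ _ ? [_ ?] _] := pot_smooth V z.
Qed.

Lemma partial_pot z x : partial x (V z \o star_gradient Gam z) =
  fun phi => \sum_i star_gradient Gam z (spike x) ord0 i
                     * pderiv i (V z) (star_gradient Gam z phi).
Proof.
apply/funext => phi; rewrite /partial derive1E.
rewrite (_ : (fun t => _) = fun t : R => V z (star_gradient Gam z phi + t *: star_gradient Gam z (spike x))).
  have [_] := is_derive_pot z (star_gradient Gam z phi) (star_gradient Gam z (spike x)) 0.
  by rewrite scale0r addr0.
by apply/funext => t; rewrite /= bump_line star_gradient_line.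
Qed.

Lemma partial_partial_pot z x y phi :
  partial y (partial x (V z \o star_gradient Gam z)) phi =
  hessian z (star_gradient Gam z phi) (star_gradient Gam z (spike x))
    (star_gradient Gam z (spike y)).
Proof.
rewrite partial_pot /partial derive1E.
set a := star_gradient Gam z (spike x); set b := star_gradient Gam z (spike y).
rewrite (_ : (fun t => _) = fun t : R => \sum_i a ord0 i
    * pderiv i (V z) (star_gradient Gam z phi + t *: b)).
  have [_] := is_derive_pderiv_pot z (star_gradient Gam z phi) a b 0.
  by rewrite scale0r addr0.
by apply/funext => t; rewrite bump_line star_gradient_line.
Qed.

Lemma hessian0l z (eta b : 'rV[R]_k) : hessian z eta 0 b = 0.
Proof.
by rewrite /hessian /bilinear big1// => i _; rewrite big1// => j _; rewrite mxE !mul0r.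
Qed.

Lemma hessian0r z (eta a : 'rV[R]_k) : hessian z eta a 0 = 0.
Proof.
by rewrite /hessian /bilinear big1// => i _; rewrite big1// => j _; rewrite mxE mulr0 mul0r.
Qed.

Lemma star_gradient_off z x : ~ gball Gam z 1 x -> star_gradient Gam z (spike x) = 0.
Proof.
move=> zx; apply/rowP => i; rewrite star_gradientE mxE /spike.
have zix : z + step i == x = false.
  apply/negP => /eqP E; apply: zx; apply/gball1P; right.
  by rewrite /adj -E addrC addKr /step mem_nth// -cardfE.
by rewrite zix; case: eqP => [E|]; rewrite ?subrr//; case: zx; rewrite -E; apply/gball1P; left.
Qed.

Definition touching (Lam : {fset site d}) : {fset site d} :=
  fset_set [set x | gball Gam x 1 `&` [set` Lam] !=set0].

Lemma touchingP Lam z : reflect (exists2 x, gball Gam z 1 x & x \in Lam)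
  (z \in touching Lam).
Proof.
rewrite in_fset_set; last exact: finite_touching.
by apply: (iffP idP); rewrite inE => -[x]; [case=> ? ?; exists x|exists x].
Qed.

Lemma hamiltonianE Lam phi :
  hamiltonian V Lam phi = \sum_(z <- touching Lam) V z (star_gradient Gam z phi).
Proof. by rewrite /hamiltonian fsbig_finite//; exact: finite_touching. Qed.

End Hessian.
Arguments spike {R d}.

Section Convexity.
Variables (R : realType) (d : nat) (Gam : {fset site d}) (c0 alpha : R).
Variable V : potential Gam c0 alpha.
Local Notation field := (field R d).

(** All vertices of the stars that enter the Hamiltonian of Lam. *)
Definition star_hull (Lam : {fset site d}) : {fset site d} :=
  [fset x in ([seq z + g | z <- enum_fset (touching Gam Lam), g <- 0 :: enum_fset Gam])%R]%fset.

Lemma star_hull_center Lam z : z \in touching Gam Lam -> z \in star_hull Lam.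
Proof.
move=> zL; rewrite inE; apply/allpairsP; exists (z, 0).
by rewrite /= addr0 mem_head.
Qed.

Lemma star_hull_step Lam z g : z \in touching Gam Lam -> g \in Gam ->
  z + g \in star_hull Lam.
Proof.
move=> zL gG; rewrite inE; apply/allpairsP; exists (z, g).
by rewrite /= inE gG orbT.
Qed.

Lemma sub_touching (Lam : {fset site d}) z : z \in Lam -> z \in touching Gam Lam.
Proof. by move=> zL; apply/touchingP; exists z => //; apply/gball1P; left. Qed.

Lemma sum_spike (W : {fset site d}) (u : field) (a : site d) : a \in W ->
  \sum_(x <- W) u x * (a == x)%:R = u a.
Proof.
move=> aW; rewrite (big_fsetD1 a)//= eqxx mulr1 big_seq big1 ?addr0// => x.
by rewrite !inE eq_sym => /andP[/negbTE -> _]; rewrite mulr0.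
Qed.

Lemma star_gradient_expand Lam z (u : field) : z \in touching Gam Lam ->
  star_gradient Gam z u =
  \sum_(x <- star_hull Lam) u x *: star_gradient Gam z (spike x).
Proof.
move=> zL; apply/rowP => i; rewrite star_gradientE summxE.
under eq_bigr do rewrite mxE star_gradientE /spike mulrBr.
rewrite sumrB !sum_spike//; first exact: star_hull_center.
by apply: star_hull_step; rewrite // /step mem_nth// -cardfE.
Qed.

Definition conductance Lam (phi : field) (x y : site d) : R :=
  - \sum_(z <- touching Gam Lam) hessian V z (star_gradient Gam z phi)
      (star_gradient Gam z (spike x)) (star_gradient Gam z (spike y)).

(** Constant fields have zero gradient, so the second derivatives have zero row
    and column sums over the star hull. *)
Lemma hessian_conductance Lam (u phi : field) :
  \sum_(z <- touching Gam Lam) hessian V z (star_gradient Gam z phi)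
     (star_gradient Gam z u) (star_gradient Gam z u) =
  2^-1 * \sum_(x <- star_hull Lam) \sum_(y <- star_hull Lam)
     conductance Lam phi x y * (u x - u y) ^+ 2.
Proof.
set W := star_hull Lam.
pose q z x y := hessian V z (star_gradient Gam z phi)
  (star_gradient Gam z (spike x)) (star_gradient Gam z (spike y)).
have flat z : star_gradient Gam z (fun=> 1 : R) = 0.
  by apply/rowP => i; rewrite star_gradientE mxE subrr.
have qsum z (a b : site d -> R) : z \in touching Gam Lam ->
    hessian V z (star_gradient Gam z phi) (star_gradient Gam z a) (star_gradient Gam z b)
    = \sum_(x <- W) \sum_(y <- W) a x * b y * q z x y.
  move=> zL; rewrite (star_gradient_expand a zL) (star_gradient_expand b zL).
  exact: bilinear_sum.
have row0 z x : z \in touching Gam Lam -> x \in W -> \sum_(y <- W) q z x y = 0.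
  move=> zL xW; have := qsum z (spike x) (fun=> 1) zL; rewrite flat hessian0r.
  rewrite (big_fsetD1 x)//= /spike eqxx [X in _ + X]big_seq [X in _ + X]big1; last first.
    by move=> x'; rewrite !inE => /andP[/negbTE -> _]; apply: big1 => y _; rewrite !mul0r.
  by rewrite addr0 => h; rewrite [RHS]h; apply: eq_bigr => y _; rewrite !mul1r.
have col0 z y : z \in touching Gam Lam -> y \in W -> \sum_(x <- W) q z x y = 0.
  move=> zL yW; have := qsum z (fun=> 1) (spike y) zL; rewrite flat hessian0l.
  rewrite exchange_big (big_fsetD1 y)//= /spike eqxx [X in _ + X]big_seq [X in _ + X]big1; last first.
    by move=> y'; rewrite !inE => /andP[/negbTE -> _]; apply: big1 => x _; rewrite !(mul0r, mulr0).
  by rewrite addr0 => h; rewrite [RHS]h; apply: eq_bigr => x _; rewrite !mul1r.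
rewrite big_seq; under eq_bigr => z zL.
  rewrite qsum// (laplacian_form (q := q z)); [over|by move=> x; exact: row0|by move=> y; exact: col0].
rewrite -big_seq -mulr_sumr; congr (_ * _).
rewrite exchange_big; apply: eq_bigr => x _ /=.
rewrite exchange_big; apply: eq_bigr => y _ /=.
by rewrite -mulr_suml sumrN.
Qed.

Hypothesis Gam_sym : forall g, (g \in Gam) = (- g \in Gam).

Lemma adj_sym x y : adj Gam x y = adj Gam y x.
Proof. by rewrite /adj Gam_sym opprB. Qed.

(** As x or y lies in Lam, every star containing both meets Lam.  The sum over
    the stars of the Hamiltonian is then the full sum in the convexity
    assumption, the other stars contributing 0. *)
Lemma conductance_ge Lam (phi : field) x y : x \in Lam \/ y \in Lam -> x != y ->
  (adj Gam x y)%:R / c0 <= conductance Lam phi x y.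
Proof.
move=> xyL xy; have [axy|naxy] := boolP (adj Gam x y); last first.
  rewrite mul0r /conductance big1 ?oppr0// => z _.
  by rewrite -partial_partial_pot pot_range// 1?eq_sym// adj_sym.
have ayx : adj Gam y x by rewrite adj_sym.
have /andP[+ _] := pot_convex V phi ayx.
rewrite mul1r => /le_trans; apply; rewrite /conductance lerN2.
set B := [set z | _].
have BL : B `<=` [set` touching Gam Lam].
  move=> z [zy zx] /=; apply/touchingP.
  by case: xyL => L; [exists x|exists y].
have finB : finite_set B by apply: (sub_finite_set BL); exact: finite_fset.
rewrite fsbig_finite// le_eqVlt; apply/orP; left; apply/eqP.
under [LHS]eq_bigr do rewrite -partial_partial_pot.
apply/esym/big_fset_incl.
  by apply/fsubsetP => z; rewrite in_fset_set// inE => /BL.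
move=> z _; rewrite in_fset_set// => /negP zB.
rewrite partial_partial_pot.
have [zx|/star_gradient_off ->] := pselect (gball Gam z 1 x); last by rewrite hessian0l.
have [zy|/star_gradient_off ->] := pselect (gball Gam z 1 y); last by rewrite hessian0r.
by case: zB; rewrite inE.
Qed.

Hypothesis c0_gt0 : 0 < c0.

(** Edges that leave the star hull carry no gradient of u, so the sum over pairs
    in the hull contains the whole energy, counted over oriented edges. *)
Lemma hessian_energy Lam (u phi : field) : (forall x, x \notin Lam -> u x = 0) ->
  (2 * c0)^-1 * \sum_(x <- star_hull Lam) local_energy Gam u x <=
  \sum_(z <- touching Gam Lam) hessian V z (star_gradient Gam z phi)
     (star_gradient Gam z u) (star_gradient Gam z u).
Proof.
move=> uL; rewrite hessian_conductance invfM -mulrA ler_wpM2l ?invr_ge0//.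
rewrite mulr_sumr big_seq [leRHS]big_seq; apply: ler_sum => x xW.
apply: (@le_trans _ _ (\sum_(y <- star_hull Lam) (adj Gam x y)%:R / c0 * (u x - u y) ^+ 2)).
  rewrite [leRHS](_ : _ = c0^-1 * \sum_(y <- star_hull Lam) (adj Gam x y)%:R * (u x - u y) ^+ 2).
    rewrite ler_wpM2l ?invr_ge0 ?(ltW c0_gt0)//.
    rewrite le_eqVlt; apply/orP; left; apply/eqP.
    pose F y := (u y - u x) ^+ 2.
    transitivity (\sum_(g <- Gam) \sum_(y <- star_hull Lam) F y * (x + g == y)%:R).
      rewrite /local_energy big_seq [RHS]big_seq; apply: eq_bigr => g gG.
      have [xgW|xgW] := boolP (x + g \in star_hull Lam); first by rewrite sum_spike.
      rewrite big_seq big1 => [|y yW]; last first.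
        case: eqP => [E|_]; last by rewrite mulr0.
        by rewrite -E (negbTE xgW) in yW.
      rewrite (uL (x + g)) ?(uL x) ?subrr ?expr0n//.
        by apply: contra xgW => /sub_touching xL; rewrite star_hull_step.
      by apply: contra xgW => /sub_touching; exact: star_hull_center.
    rewrite exchange_big; apply: eq_bigr => y _ /=; rewrite -mulr_sumr mulrC /F.
    rewrite -sqrrN opprB; congr (_ * _); rewrite /adj.
    have E g : x + g == y = (g == y - x) by rewrite [RHS]eq_sym subr_eq [g + x]addrC [RHS]eq_sym.
    have [yG|yG] := boolP (y - x \in Gam).
      rewrite (big_fsetD1 (y - x))//= E eqxx big_seq big1 ?addr0// => g.
      by rewrite !inE E => /andP[/negbTE ->].
    rewrite big_seq big1// => g gG; rewrite E; case: eqP => // gE.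
    by rewrite -gE gG in yG.
  by rewrite [RHS]mulr_sumr; apply: eq_bigr => y _; ring.
rewrite big_seq [leRHS]big_seq; apply: ler_sum => y yW.
have [->|xy] := eqVneq x y; first by rewrite subrr expr0n !mulr0.
have [xL|xL] := boolP (x \in Lam).
  by rewrite ler_wpM2r ?sqr_ge0//; apply: conductance_ge => //; left.
have [yL|yL] := boolP (y \in Lam).
  by rewrite ler_wpM2r ?sqr_ge0//; apply: conductance_ge => //; right.
by rewrite !uL// subrr expr0n !mulr0.
Qed.

Lemma star_hull_closed Lam (u : field) : (forall x, x \notin Lam -> u x = 0) ->
  forall x g, x \notin star_hull Lam -> g \in Gam -> u (x + g) = u x.
Proof.
move=> uL x g xW gG.
have xL : x \notin Lam by apply: contra xW => /sub_touching; exact: star_hull_center.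
rewrite uL ?(uL x)//; apply: contra xW => /sub_touching xgL.
by rewrite -(addrK g x) star_hull_step// -Gam_sym.
Qed.

End Convexity.

(** The second derivative of H along the line from psi to phi dominates the
    Dirichlet energy of (phi - psi)/2, and by transience the square of its value
    at y. *)
Lemma hamiltonian_convex (R : realType) (d : nat) (Gam : {fset site d}) (c0 : R) :
  (3 <= d)%N -> admissible_steps Gam -> 0 < c0 ->
  exists2 kap : R, 0 < kap & forall alpha (V : potential Gam c0 alpha)
    (Lam : {fset site d}) (phi psi : field R d),
    (forall x, x \notin Lam -> phi x = 0) -> (forall x, x \notin Lam -> psi x = 0) ->
    forall y, kap * (phi y - psi y) ^+ 2 <=
      hamiltonian V Lam phi + hamiltonian V Lam psi
      - 2 * hamiltonian V Lam (midpoint phi psi).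
Proof.
move=> d3 adm c0_gt0; have [C C0 trans] := transience_inequality R d3 adm.
have [_ Gam_sym _] := adm.
have k0 : 0 < (8 * c0 * C)^-1 by rewrite invr_gt0 !mulr_gt0.
exists (8 * c0 * C)^-1 => // alpha V Lam phi psi phi0 psi0 y.
pose m := midpoint phi psi; pose u : field R d := fun z => (phi z - psi z) / 2.
have u0 x : x \notin Lam -> u x = 0 by move=> xL; rewrite /u phi0// psi0// subrr mul0r.
pose sg := star_gradient Gam.
pose p (t : R) := \sum_(z <- touching Gam Lam) V z (sg R z m + t *: sg R z u).
have pE t : p t = hamiltonian V Lam (line m u t).
  by rewrite hamiltonianE; apply: eq_bigr => z _; rewrite star_gradient_line.
have := @second_difference_ge R p
  (fun t => \sum_(z <- touching Gam Lam)
     \sum_i sg R z u ord0 i * pderiv i (V z) (sg R z m + t *: sg R z u))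
  (fun t => \sum_(z <- touching Gam Lam)
     hessian V z (sg R z m + t *: sg R z u) (sg R z u) (sg R z u))
  ((8 * c0 * C)^-1 * (phi y - psi y) ^+ 2).
rewrite !pE.
have -> : line m u 1 = phi.
  by apply/funext => z; rewrite /line /m /u /midpoint; field.
have -> : line m u (-1) = psi.
  by apply/funext => z; rewrite /line /m /u /midpoint; field.
have -> : line m u 0 = m by apply/funext => z; rewrite /line mul0r addr0.
apply.
- move=> t; apply: (@is_derive_sum_fun R _ _ (fun z s => V z (sg R z m + s *: sg R z u))
   (fun z s => \sum_i sg R z u ord0 i * pderiv i (V z) (sg R z m + s *: sg R z u))).
  by move=> z; exact: is_derive_pot.
- move=> t; apply: (@is_derive_sum_fun R _ _
   (fun z s => \sum_i sg R z u ord0 i * pderiv i (V z) (sg R z m + s *: sg R z u))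
   (fun z s => hessian V z (sg R z m + s *: sg R z u) (sg R z u) (sg R z u))).
  by move=> z; exact: is_derive_pderiv_pot.
move=> t; under eq_bigr do rewrite -star_gradient_line.
apply: le_trans (hessian_energy V Gam_sym c0_gt0 (line m u t) u0).
have := trans Lam (star_hull Gam Lam) u u0 (star_hull_closed Gam_sym u0) y.
have c2 : 0 <= (2 * c0)^-1 by rewrite invr_ge0 mulr_ge0// ltW.
rewrite -ler_pdivrMl// => /(ler_wpM2l c2); apply: le_trans; rewrite le_eqVlt; apply/orP; left; apply/eqP.
by rewrite /u; field; rewrite !gt_eqF.
Qed.

(** * Gaussian tails of the Gibbs measure *)

Section Reflection.
Variables (R : realType) (d : nat).
Local Notation field := (field R d).
Local Notation leb := (@lebesgue_measure R).
Local Open Scope ereal_scope.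

Lemma integral_opp (f : measurableTypeR R -> \bar R) :
  measurable_fun setT f -> (forall t, 0 <= f t) ->
  \int[leb]_t f (- t)%R = \int[leb]_t f t.
Proof.
move=> mf f0; rewrite -[setT in LHS](preimage_setT (-%R : R -> measurableTypeR R)).
rewrite -(ge0_integral_pushforward (phi := (-%R : measurableTypeR R -> measurableTypeR R)))//.
by apply: eq_measure_integral => //= A mA AS; exact: lebesgue_measureN.
Qed.

Definition opp_field (phi : field) : field := fun z => (- phi z)%R.

Lemma measurable_opp_field : measurable_fun setT opp_field.
Proof.
by apply: measurable_to_field => x; apply: measurableT_comp => //; exact: measurable_coord.
Qed.

Lemma integral_opp_field (s : seq (site d)) (f : field -> \bar R) :
  measurable_fun setT f -> (forall phi, 0 <= f phi) ->
  \int[lebesgue_seq (fun=> 0%R) s]_phi f (opp_field phi) =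
  \int[lebesgue_seq (fun=> 0%R) s]_phi f phi.
Proof.
elim: s f => [|x s IH] f mf f0 /=.
  have mfo := measurableT_comp mf measurable_opp_field.
  rewrite !integral_dirac// !diracT !mul1e; congr f.
  by apply/funext => z; rewrite /opp_field oppr0.
have mfo := measurableT_comp mf measurable_opp_field.
rewrite (integral_lebesgue_add _ x mf f0).
rewrite (integral_lebesgue_add _ x mfo (fun phi => f0 (opp_field phi))).
have mup : measurable_fun setT (fun p : field * measurableTypeR R => f (update x p)).
  by apply: measurableT_comp => //; exact: measurable_update.
rewrite -(IH (fun phi => \int[leb]_t f (update x (phi, t)))); last 2 first.
- exact: (measurable_fun_fubini_tonelli_F (m2 := leb) _ mup (fun p => f0 _)).
- by move=> phi; exact: integral_ge0.
apply: eq_integral => phi _.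
rewrite -(integral_opp (f := fun t => f (update x (opp_field phi, t))))//; last first.
  by apply: (measurableT_comp mup); exact: measurable_pair1.
apply: eq_integral => t _; congr f; apply/funext => z.
by rewrite /opp_field /update /=; case: eqP.
Qed.

End Reflection.

Section Monotone.
Context d (T : measurableType d) (R : realType).
Local Open Scope ereal_scope.

(** The integral of a nonnegative function is a supremum over the simple
    functions below it, hence monotone for arbitrary functions.  So are the Gibbs
    measures on arbitrary sets, and the bad event can be compared directly with a
    measurable one. *)
Lemma ge0_integral_mono (m : {measure set T -> \bar R}) (f g : T -> \bar R) :
  (forall x, 0 <= f x) -> (forall x, f x <= g x) ->
  \int[m]_x f x <= \int[m]_x g x.
Proof.
move=> f0 fg; have g0 x : 0 <= g x := le_trans (f0 x) (fg x).
rewrite !ge0_integralTE//; apply: ereal_sup_le => _ [h hf <-].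
by exists h => // x; exact: le_trans (fg x).
Qed.

Lemma ge0_integral_subset_mono (m : {measure set T -> \bar R}) (f : T -> \bar R)
    (A B : set T) : (forall x, 0 <= f x) -> A `<=` B ->
  \int[m]_(x in A) f x <= \int[m]_(x in B) f x.
Proof.
move=> f0 AB; rewrite integral_mkcond [leRHS]integral_mkcond.
apply: ge0_integral_mono => x; rewrite !patchE; first by case: ifP.
case: ifPn => [xA|_]; last by case: ifP.
by rewrite ifT// inE; apply: AB; rewrite -inE.
Qed.

End Monotone.

Section GibbsTail.
Variables (R : realType) (d : nat) (Gam : {fset site d}) (c0 alpha : R).
Variable V : potential Gam c0 alpha.
Local Notation field := (field R d).
Local Notation gibbs0 Lam := (gibbs V Lam (fun=> 0%R : R)).

Lemma gibbs_mono Lam xi (A B : set field) : A `<=` B ->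
  (gibbs V Lam xi A <= gibbs V Lam xi B)%E.
Proof.
move=> AB; rewrite /gibbs /= /mnormalize; case: ifP => _ /=.
  rewrite !diracE lee_fin; case: (boolP (xi \in A)) => //.
  by rewrite inE => /AB xB; rewrite [xi \in B]mem_set.
apply: lee_wpmul2r; first by rewrite lee_fin invr_ge0 fine_ge0.
rewrite /density; apply: ge0_integral_subset_mono => // phi.
by rewrite lee_fin boltzmann_ge0.
Qed.

Lemma gibbs_pair_mono Lam (A B : set (field * field)) : A `<=` B ->
  (gibbs_pair V Lam A <= gibbs_pair V Lam B)%E.
Proof.
move=> AB; rewrite /gibbs_pair /product_measure1.
apply: ge0_integral_mono => phi //=.
by apply: gibbs_mono => psi; rewrite !xsectionE; exact: AB.
Qed.

Lemma hamiltonian_opp Lam (phi : field) :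
  hamiltonian V Lam (opp_field phi) = hamiltonian V Lam phi.
Proof.
rewrite !hamiltonianE; apply: eq_bigr => z _; rewrite pot_sym; congr (V z _).
by apply/rowP => i; rewrite mxE !star_gradientE /opp_field opprB opprK addrC.
Qed.

Variable kap : R.
Hypothesis kap_gt0 : 0 < kap.
Variable Lam : {fset site d}.
Hypothesis convexH : forall phi psi : field,
    (forall x, x \notin Lam -> phi x = 0) -> (forall x, x \notin Lam -> psi x = 0) ->
    forall y, kap * (phi y - psi y) ^+ 2 <=
      hamiltonian V Lam phi + hamiltonian V Lam psi
      - 2 * hamiltonian V Lam (midpoint phi psi).

Local Notation flat := (lebesgue_on Lam (fun=> 0%R : R)).

Definition partition_function : \bar R := (\int[flat]_phi (boltzmann V Lam phi)%:E)%E.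
Definition tilted (l : R) y (phi : field) : R := expR (l * phi y) * boltzmann V Lam phi.

Lemma measurable_tilted l y : measurable_fun setT (tilted l y).
Proof.
apply: measurable_funM; last exact: measurable_boltzmann.
apply: measurableT_comp => //; apply: measurable_funM => //.
exact: measurable_coord.
Qed.

(** Prekopa-Leindler for the tilts by l and -l, whose integrals are exchanged by
    the reflection phi -> - phi. *)
Lemma tilted_moment l y : (0 < partition_function)%E -> partition_function \is a fin_num ->
  (\int[flat]_phi (tilted l y phi)%:E
     <= (expR (l ^+ 2 / (8 * kap)))%:E * partition_function)%E.
Proof.
move=> Z0 Zfin; set I := (\int[_]_ _ _)%E; set c := expR _.
have c0' : 0 < c by exact: expR_gt0.
have mt l' : measurable_fun setT (fun phi => (tilted l' y phi)%:E).
  by apply/measurable_EFinP; exact: measurable_tilted.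
have t0 l' phi : (0 <= (tilted l' y phi)%:E)%E.
  by rewrite lee_fin mulr_ge0// ?expR_ge0 ?boltzmann_ge0.
have mb : measurable_fun setT (fun phi => (boltzmann V Lam phi)%:E).
  by apply/measurable_EFinP; exact: measurable_boltzmann.
have opp_tilt phi : tilted l y (opp_field phi) = tilted (- l) y phi.
  by rewrite /tilted /boltzmann hamiltonian_opp /opp_field mulrN mulNr.
have refl : (\int[flat]_phi (tilted (- l) y phi)%:E = I)%E.
  rewrite /I -(integral_opp_field _ (mt l) (t0 l)).
  by apply: eq_integral => phi _; rewrite opp_tilt.
have : (I * I <= (c%:E * partition_function) ^+ 2)%E.
  have <- : (\int[flat]_phi (c%:E * (boltzmann V Lam phi)%:E) = c%:E * partition_function)%E.
    rewrite (ge0_integralZl _ measurableT mb)//; last by rewrite lee_fin ltW.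
    by move=> phi _; rewrite lee_fin boltzmann_ge0.
  rewrite -[X in (_ * X)%E]refl.
  apply: (prekopa_leindler (h := fun phi => (c%:E * (boltzmann V Lam phi)%:E)%E)).
  - exact: mt.
  - exact: mt.
  - exact: measurable_funeM.
  - exact: t0.
  - exact: t0.
  - by move=> phi; apply: mule_ge0; rewrite lee_fin; [exact: ltW|exact: boltzmann_ge0].
  move=> phi psi phi0 psi0.
  rewrite expe2 -!EFinM lee_fin /tilted /boltzmann /c -!expRD ler_expR.
  have := convexH phi0 psi0 y.
  set w := phi y - psi y; set H1 := hamiltonian _ _ _; set H2 := hamiltonian _ _ _.
  set H3 := hamiltonian _ _ _.
  (* Completing the square in w = phi_y - psi_y. *)
  have sq : 0 <= kap * (w - l / (2 * kap)) ^+ 2 by rewrite mulr_ge0 ?sqr_ge0 ?ltW.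
  have -> : l ^+ 2 / (8 * kap) = (kap * (w - l / (2 * kap)) ^+ 2 - kap * w ^+ 2 + l * w) / 2.
    by field; rewrite gt_eqF.
  by rewrite /w in sq *; lra.
move=> II; rewrite leNgt; apply/negP.
have cZ0 : (0 < c%:E * partition_function)%E by rewrite mule_gt0 ?lte_fin.
have cZfin : (c%:E * partition_function)%E \is a fin_num by rewrite fin_numM.
move: cZ0 cZfin II; rewrite expe2; case: (c%:E * _)%E => [r| |]// r0 _.
case: I refl => [i _|_|//]; last by rewrite mulyy leye_eq.
rewrite -!EFinM lee_fin !lte_fin => ir ri; rewrite lte_fin in r0.
by move: ir; apply/negP; rewrite -ltNge; nra.
Qed.

(** Chernoff's bound; l = 4 kap m b optimizes e^{-l m + l^2/(8 kap)}.  When the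
    partition function is 0 or infinite, the normalized measure is the Dirac mass
    at 0, which gives the event probability 0. *)
Lemma gibbs_tail (b m : R) y : b ^+ 2 = 1 -> 0 <= m ->
  (gibbs0 Lam [set phi | m < b * phi y]%R <= (expR (- (2 * kap * m ^+ 2)))%:E)%E.
Proof.
move=> b1 m0; rewrite /gibbs /= /mnormalize; case: ifP => [_|/negbT] /=.
  rewrite diracE memNset ?lee_fin ?expR_ge0//=.
  by rewrite mulr0 => /lt_geF; rewrite m0.
have -> : density (lebesgue_on Lam (fun=> 0%R : R)) (measurable_boltzmann V Lam)
  (boltzmann_ge0 V Lam) setT = partition_function by [].
rewrite negb_or => /andP[Zn0 Znoo].
have Zge0 : (0 <= partition_function)%E.
  by apply: integral_ge0 => phi _; rewrite lee_fin boltzmann_ge0.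
have Z0 : (0 < partition_function)%E by rewrite lt_neqAle eq_sym Zn0.
have Zfin : partition_function \is a fin_num by rewrite ge0_fin_numE// ltey.
set l := 4 * kap * m * b.
have tiltedE phi : m < b * phi y ->
    boltzmann V Lam phi <= expR (- (4 * kap * m ^+ 2)) * tilted l y phi.
  move=> mphi; rewrite /tilted mulrA -expRD ler_peMl ?boltzmann_ge0//.
  rewrite -[leLHS]expR0 ler_expR /l.
  have -> : - (4 * kap * m ^+ 2) + 4 * kap * m * b * phi y = 4 * kap * m * (b * phi y - m).
    by ring.
  by rewrite !mulr_ge0// ?subr_ge0 ltW.
have main : (density flat (measurable_boltzmann V Lam) (boltzmann_ge0 V Lam)
    [set phi | m < b * phi y]%R <= (expR (- (2 * kap * m ^+ 2)))%:E * partition_function)%E.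
  have -> : - (2 * kap * m ^+ 2) = - (4 * kap * m ^+ 2) + l ^+ 2 / (8 * kap).
    rewrite /l exprMn b1; field; exact: lt0r_neq0.
  rewrite expRD EFinM -muleA.
  apply: (@le_trans _ _ ((expR (- (4 * kap * m ^+ 2)))%:E * \int[flat]_phi (tilted l y phi)%:E)%E).
    have mt : measurable_fun setT (fun phi => (tilted l y phi)%:E).
      by apply/measurable_EFinP; exact: measurable_tilted.
    have t0 phi : (0 <= (tilted l y phi)%:E)%E.
      by rewrite lee_fin mulr_ge0// ?expR_ge0 ?boltzmann_ge0.
    rewrite -ge0_integralZl//.
    rewrite /density integral_mkcond; apply: ge0_integral_mono => phi; rewrite patchE.
      by case: ifP => _ //; rewrite lee_fin boltzmann_ge0.
    case: ifPn => [|_]; first by rewrite inE /= -EFinM lee_fin; exact: tiltedE.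
    by rewrite -EFinM lee_fin !mulr_ge0// ?expR_ge0 ?boltzmann_ge0.
  by apply: lee_wpmul2l; [rewrite lee_fin expR_ge0|exact: tilted_moment].
rewrite lee_pdivrMr; first by rewrite fineK.
by rewrite fine_gt0// Z0 ltey.
Qed.

(** If phi_y - psi_y > M, then phi_y > M/2 or psi_y < - M/2. *)
Lemma gibbs_pair_tail (B : {fset site d}) (M : R) : 0 <= M ->
  (gibbs_pair V Lam [set om : field * field | exists2 y, y \in B & (M < om.1 y - om.2 y)%R]
   <= (2 * #|` B|%:R * expR (- (kap / 2 * M ^+ 2)))%:E)%E.
Proof.
move=> M0; pose g := gibbs0 Lam.
have mhalf (b : R) y : measurable [set phi : field | M / 2 < b * phi y].
  rewrite -[X in measurable X]setTI.
  rewrite (_ : [set _ | _] = (fun phi : field => b * phi y) @^-1` `]M / 2, +oo[%classic).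
    by apply: measurable_funM => //; exact: measurable_coord.
  by apply/seteqP; split => phi /=; rewrite in_itv /= andbT.
pose U y : set (field * field) := [set phi | M / 2 < 1 * phi y]%R `*` setT
  `|` setT `*` [set phi | M / 2 < -1 * phi y]%R.
have mU y : measurable (U y) by apply: measurableU; apply: measurableX.
have tail b y : b ^+ 2 = 1 -> (g [set phi | M / 2 < b * phi y]%R <= (expR (- (kap / 2 * M ^+ 2)))%:E)%E.
  move=> b1; have M2 : 0 <= M / 2 by rewrite divr_ge0.
  by have := gibbs_tail y b1 M2; rewrite (_ : 2 * kap * _ = kap / 2 * M ^+ 2)//; field.
have UM y : ((g \x g) (U y) <= (2 * expR (- (kap / 2 * M ^+ 2)))%:E)%E.
  apply: le_trans (measureU2 _ _ _) _; [exact: measurableX..|].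
  rewrite mulr_natl mulr2n EFinD; apply: leeD.
    have /= -> := product_measure1E g g (mhalf 1 y) measurableT.
    by rewrite probability_setT mule1; apply: tail; rewrite expr1n.
  have /= -> := product_measure1E g g measurableT (mhalf (-1) y).
  by rewrite probability_setT mul1e; apply: tail; rewrite sqrrN expr1n.
have seq_bound (s : seq (site d)) :
   ((g \x g) (\big[setU/set0]_(y <- s) U y) <= (2 * (size s)%:R * expR (- (kap / 2 * M ^+ 2)))%:E)%E.
  elim: s => [|y s IH]; first by rewrite big_nil measure0 mulr0 mul0r.
  rewrite big_cons; apply: le_trans (measureU2 _ _ _) _ => //.
    by apply: bigsetU_measurable.
  rewrite /= -[(size s).+1%:R]natr1 mulrDr mulr1 mulrDl addrC EFinD; exact: leeD.
apply: le_trans (seq_bound B).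
apply: gibbs_pair_mono => -[phi psi] /= [y yB Mxy].
rewrite -bigcup_fset; exists y => //=.
have [h|h] := ltP (M / 2) (phi y); [left|right]; split => //=; rewrite ?mul1r// mulN1r.
by move: Mxy h; lra.
Qed.

End GibbsTail.

(** * The exit law and the bad event *)

Section ExitLaw.
Context (R : realType) (d : nat) (Gam : {fset site d}) (c0 alpha : R).
Variable V : potential Gam c0 alpha.
Variables (Lam : {fset site d}) (x : site d).
Context (d' : measure_display) (T : measurableType d') (P : probability T R).

Lemma cond_expectation_le (B : set T) (f : T -> R) (M : R) :
  measurable B -> 0 <= M -> (forall w, B w -> f w <= M) ->
  cond_expectation P B f <= M.
Proof.
move=> mB M0 fM; rewrite /cond_expectation.
have PB0 : 0 <= fine (P B) by rewrite fine_ge0.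
have [->|PBn0] := eqVneq (fine (P B)) 0; first by rewrite invr0 mulr0.
have PB : 0 < fine (P B) by rewrite lt_neqAle eq_sym PBn0.
rewrite ler_pdivrMr//.
have : (\int[P]_(w in B) (f w)%:E <= (M * fine (P B))%:E)%E.
  rewrite integralE; apply: (@le_trans _ _ (\int[P]_(w in B) (EFin \o f)^\+ w)%E).
    by rewrite geeDl// oppe_le0; apply: integral_ge0.
  rewrite EFinM fineK ?fin_num_measure// -integral_cst//.
  rewrite [leLHS]integral_mkcond [leRHS]integral_mkcond; apply: ge0_integral_mono => w.
    by rewrite patchE; case: ifP.
  rewrite !patchE; case: ifPn => // /set_mem Bw.
  by rewrite funeposE /= ge_max !lee_fin fM.
case: (integral _ _ _) => [r| |]; rewrite ?lee_fin//= => _.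
by rewrite mulr_ge0.
Qed.

Variables (clock : nat -> Gam -> T -> R) (Phi : R -> T -> field R d) (X : R -> T -> site d).
Hypothesis walk : environment_walk V Lam x clock Phi X.

(** A path either stays in Lam or is frozen from its first jump out of Lam. *)
Lemma walk_exit w :
  (forall t, 0 <= t -> X t w \in Lam) \/
  exists (s : R) (y : site d), [/\ 0 <= s, y \notin Lam,
    forall t, 0 <= t -> t < s -> X t w \in Lam &
    forall t, s <= t -> X t w = y].
Proof.
have [jt [Y [[jt0 Y0] stepin stepout pos]]] := walk_path walk w.
have [allin|/existsNP[N0 /negP YN0]] := pselect (forall k, Y k \in Lam).
  by left => t t0; have [k [_ _ ->]] := pos _ t0.
right.
have exN : exists n, Y n \notin Lam by exists N0.
case: (ex_minnP exN) => N YN Nmin.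
have before k : (k < N)%N -> Y k \in Lam.
  by move=> kN; apply/negPn/negP => /Nmin; rewrite leqNgt kN.
have jt_nd k : jt k <= jt k.+1.
  have [/stepin[y [/ltW]]//|/stepout[-> _]//] := boolP (Y k \in Lam).
have jt_mono : {homo jt : m n / (m <= n)%N >-> m <= n}.
  by apply: homo_leq => // a b c; exact: le_trans.
have after k : jt (N + k)%N = jt N /\ Y (N + k)%N = Y N.
  elim: k => [|k [IH1 IH2]]; first by rewrite addn0.
  by have := stepout (N + k)%N; rewrite IH2 addnS => /(_ YN)[-> ->].
have jtN0 : 0 <= jt N by rewrite -jt0 jt_mono.
exists (jt N), (Y N); split => // t.
  move=> t0 tN; have [k [kt _ ->]] := pos _ t0; apply: before.
  rewrite ltnNge; apply/negP => Nk; move: kt; rewrite -(subnKC Nk).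
  by have [-> _] := after (k - N)%N; rewrite leNgt tN.
move=> Nt; have [k [_ kin ->]] := pos _ (le_trans jtN0 Nt).
have [kN|Nk] := ltnP k N.
  have := kin (before _ kN) => /(le_lt_trans Nt); rewrite ltNge.
  by rewrite jt_mono.
by rewrite -(subnKC Nk); have [] := after (k - N)%N.
Qed.

Lemma exit_site_stay w : (forall t, 0 <= t -> X t w \in Lam) ->
  exit_site Lam X w = X 0 w.
Proof.
move=> stay; rewrite /exit_site /exit_time (_ : [set t | _] = set0) ?inf0//.
by rewrite -subset0 => t [t0]; rewrite stay// ltW.
Qed.

Lemma exit_site_leave w (s : R) (y : site d) : 0 <= s -> y \notin Lam ->
  (forall t, 0 <= t -> t < s -> X t w \in Lam) -> (forall t, s <= t -> X t w = y) ->
  exit_site Lam X w = y.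
Proof.
move=> s0 yL before after; rewrite /exit_site /exit_time.
set E := [set t | _]; have above t : s < t -> E t.
  by move=> st; split; [exact: le_lt_trans st|rewrite after// ltW].
suff -> : inf E = s by rewrite after.
have lbs : lbound E s.
  move=> t [t0 tL]; rewrite leNgt; apply: contra tL => ts.
  by rewrite before// ltW.
apply/eqP; rewrite eq_le; apply/andP; split; last first.
  by apply: lb_le_inf => //; exists (s + 1); apply: above; rewrite ltrDl.
apply/ler_addgt0Pr => e e0; apply: ge_inf; first by exists s.
by apply: above; rewrite ltrDl.
Qed.

(** After its exit the walk no longer moves, so its exit site outside Lam can be
    read off at integer times; this is what makes the exit site measurable. *)
Lemma exit_site_preimage (A : set (site d)) : (forall z, A z -> z \notin Lam) ->
  exit_site Lam X @^-1` A = \bigcup_n X n%:R @^-1` A.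
Proof.
move=> AL; apply/seteqP; split => w /=.
  have [stay|[s [y [s0 yL before after]]]] := walk_exit w.
    by rewrite exit_site_stay// => /AL; rewrite stay.
  rewrite (exit_site_leave s0 yL before after) => Ay.
  exists (Num.truncn s).+1 => //=; rewrite after//.
  by have /andP[_ /ltW] := truncn_itv s0.
move=> [n _ /= An].
have [stay|[s [y [s0 yL before after]]]] := walk_exit w.
  by move: (AL _ An); rewrite stay.
rewrite (exit_site_leave s0 yL before after) -(after n%:R)// leNgt.
by apply/negP => ns; move: (AL _ An); rewrite before.
Qed.

Lemma measurable_exit_site (A : set (site d)) : (forall z, A z -> z \notin Lam) ->
  measurable (exit_site Lam X @^-1` A).
Proof.
move=> AL; rewrite exit_site_preimage//; apply: bigcup_measurable => n _.
rewrite (_ : _ @^-1` A = \bigcup_(y in A) X n%:R @^-1` [set y]); last first.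
  apply/seteqP; split => w /=; first by move=> Aw; exists (X n%:R w).
  by move=> [y Ay /= ->].
rewrite bigcup_mkcond; apply: countable_bigcupT_measurable; first exact: countableP.
by move=> y; case: ifP => _ //; exact: (walk_meas walk).
Qed.

End ExitLaw.

Section BadEvent.
Variables (R : realType) (d : nat) (Gam : {fset site d}) (c0 alpha : R).
Variable V : potential Gam c0 alpha.

(** The value is that of some realization of the walk, or the default 0. *)
Lemma cond_exit_expectation_le Lam xi x phi (A : set (site d)) (f : site d -> R) (M : R) :
  (forall z, A z -> z \notin Lam) -> 0 <= M -> (forall z, A z -> f z <= M) ->
  cond_exit_expectation V Lam xi x phi A f <= M.
Proof.
move=> AL M0 fM; rewrite /cond_exit_expectation; case: xgetP => [r _|]//.
move=> [d' [T [P [Phi [X [[B [clock [_ _ walk]]] ->]]]]]].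
apply: cond_expectation_le => //; first exact: (measurable_exit_site walk AL).
by move=> w /= Aw; exact: fM.
Qed.

Lemma sub_inner_boundary (S' : {fset site d}) :
  inner_boundary Gam [set` S'] `<=` [set` S'].
Proof. by move=> z [/contrapT]. Qed.

Lemma finite_inner_boundary (S' : {fset site d}) :
  finite_set (inner_boundary Gam [set` S']).
Proof. by apply: sub_finite_set (@sub_inner_boundary S') _; exact: finite_fset. Qed.

Lemma bad_event_sub (S S' : {fset site d}) (eps : R) (Lam : {fset site d}) (M : R) : 0 <= M ->
  bad_event V S S' eps Lam M `<=`
  [set om | exists2 y, y \in fset_set (inner_boundary Gam [set` S']) & M < om.1 y - om.2 y].
Proof.
move=> M0 om [t _ [p _]] /=; apply: contraPP => none; apply/negP; rewrite -leNgt.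
apply: cond_exit_expectation_le => // z zA.
  by rewrite !inE negb_and negbK (sub_inner_boundary zA).
rewrite leNgt; apply/negP => Mz; apply: none; exists z => //.
by rewrite in_fset_set ?inE//; exact: finite_inner_boundary.
Qed.

End BadEvent.

(** * Green function and capacity *)

Section SigmaStar.
Variables (R : realType) (d : nat) (Gam : {fset site d}).

Lemma green_ge0 (x y : site d) : 0 <= green R Gam x y.
Proof.
rewrite /green; case: xgetP => [r _ [d' [T [P [Z [_ ->]]]]]|_]//.
by rewrite fine_ge0//; apply: integral_ge0 => w _; apply: integral_ge0 => t _; rewrite lee_fin.
Qed.

(** The value 0 absorbs the conventions sup = 0 for unbounded sets and a/0 = 0. *)
Lemma sup_div_inf (A : set R) : (forall a, A a -> 0 <= a) ->
  sup A / inf A = 0 \/ 1 <= sup A / inf A.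
Proof.
move=> A0; have [->|iA] := eqVneq (inf A) 0; first by left; rewrite invr0 mulr0.
have [hasA|nhasA] := pselect (has_sup A); last by left; rewrite sup_out// mul0r.
right; have [[a Aa] ubA] := hasA.
have ia : inf A <= a by apply: ge_inf => //; exists 0.
have iA0 : 0 < inf A.
  by rewrite lt_neqAle eq_sym iA; apply: lb_le_inf; [exists a|exact: A0].
by rewrite ler_pdivlMr// mul1r (le_trans ia)//; exact: ub_le_sup.
Qed.

Lemma sigma_star_cases (S S' : {fset site d}) :
  sigma_star R Gam S S' = 0 \/ 1 <= sigma_star R Gam S S'.
Proof.
rewrite /sigma_star; set B := [set _ | x in _].
have B01 b : B b -> b = 0 \/ 1 <= b.
  by move=> [x _ <-]; apply: sup_div_inf => _ [y _ <-]; exact: green_ge0.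
have [[[b Bb] ubB]|nhasB] := pselect (has_sup B); last by left; rewrite sup_out.
have [[c [Bc c1]]|none] := pselect (exists c, B c /\ 1 <= c).
  by right; apply: (le_trans c1); exact: ub_le_sup.
left; rewrite (_ : B = [set 0]) ?sup1//; apply/seteqP; split => [c Bc|_ ->] /=.
  by case: (B01 _ Bc) => // c1; case: none; exists c.
case: (B01 _ Bb) => [<-//|b1]; by case: none; exists b.
Qed.

End SigmaStar.

Section Capacity.
Variables (R : realType) (d : nat) (Gam : {fset site d}).

Section Walk.
Context (d' : measure_display) (T : measurableType d') (P : probability T R).
Variables (y : site d) (Z : R -> T -> site d) (J : nat -> T -> Gam) (W : nat -> T -> R).
Hypothesis mJ : forall k g, measurable (J k @^-1` [set g]).
Hypothesis pathZ : forall w, (forall k, 0 < W k w) /\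
  forall t, 0 <= t -> exists n,
    \sum_(k < n) W k w <= t < \sum_(k < n.+1) W k w /\
    Z t w = y + \sum_(k < n) val (J k w).

Let disp n w : site d := \sum_(k < n) val (J k w).

Lemma measurable_displacement n (z : site d) : measurable [set w | disp n w = z].
Proof.
elim: n z => [|n IH] z.
  have [->|z0] := eqVneq z 0.
    rewrite (_ : [set w | _] = setT)//.
    by apply/seteqP; split => w //= _; rewrite /disp big_ord0.
  rewrite (_ : [set w | _] = set0)// -subset0 => w /=; rewrite /disp big_ord0.
  by move/eqP; rewrite eq_sym (negbTE z0).
rewrite (_ : [set w | _] = \bigcup_(g in [set: Gam])
    ([set w | disp n w = z - val g] `&` (J n @^-1` [set g]))).
  by apply: fin_bigcup_measurable => // g _; apply: measurableI.
apply/seteqP; split => w /=.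
  rewrite /disp big_ord_recr /= => <-; exists (J n w) => //; split => //=.
  by rewrite addrK.
move=> [g _ [/= e Jg]]; rewrite /disp big_ord_recr /= -/(disp n w) e Jg.
by rewrite subrK.
Qed.

(** The walk returns to U after having moved iff its jump chain does: m <= n are
    the numbers of jumps made at a time s when the walk is off its starting point
    and at a later time t when it is in U.  Conversely the fractions 1/3 and 1/2
    of the holding times give s < t even if m = n. *)
Lemma return_timeE (U : {fset site d}) :
  [set w | return_time U Z w = +oo%E] =
  ~` \bigcup_m \bigcup_(n in [set n | (m <= n)%N])
     [set w | disp m w <> 0 /\ y + disp n w \in U].
Proof.
have Wpos w k : 0 < W k w by have [Wp _] := pathZ w.
pose S n w := \sum_(k < n) W k w.
have Smono w : {homo (S ^~ w) : m n / (m <= n)%N >-> m <= n}.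
  apply: homo_leq => // [a b c|n]; first exact: le_trans.
  by rewrite /S big_ord_recr /= lerDl ltW.
have S0 w : S 0%N w = 0 by rewrite /S big_ord0.
have Sge0 w n : 0 <= S n w by rewrite -(S0 w) Smono.
have ZE w n t : S n w <= t -> t < S n.+1 w -> Z t w = y + disp n w.
  move=> nt tn; have [_ /(_ _ (le_trans (Sge0 w n) nt))] := pathZ w.
  move=> [m [/andP[mt tm] ->]]; suff -> : m = n by [].
  apply/eqP; rewrite eqn_leq; apply/andP; split; rewrite leqNgt; apply/negP => lt.
    by have := le_lt_trans (le_trans (Smono w _ _ lt) mt) tn; rewrite ltxx.
  by have := le_lt_trans (le_trans (Smono w _ _ lt) nt) tm; rewrite ltxx.
have Z0 w : Z 0 w = y.
  rewrite (ZE w 0%N) ?S0//; first by rewrite /disp big_ord0 addr0.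
  by rewrite /S big_ord1.
apply/seteqP; split => w /=.
  move=> ret [m _ [n /= mn [Dm Un]]].
  pose t := S n w + W n w / 2; pose s := S m w + W m w / 3.
  have [Wn Wm] := (Wpos w n, Wpos w m).
  have SS k : S k.+1 w = S k w + W k w by rewrite /S big_ord_recr.
  have Zt : Z t w = y + disp n w by apply: ZE; rewrite ?SS /t; lra.
  have Zs : Z s w = y + disp m w by apply: ZE; rewrite ?SS /s; lra.
  have st : s < t.
    move: mn; rewrite leq_eqVlt => /orP[/eqP E|mn].
      by rewrite /s /t -E; lra.
    by have := Smono w _ _ mn; rewrite SS /s /t; lra.
  have s0 : 0 < s by have := Sge0 w m; rewrite /s; lra.
  have := @ereal_inf_lbound _ _ t%:E
    (_ : [set t%:E | t in [set t | [/\ 0 < t, Z t w \in U &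
       exists s, 0 < s < t /\ Z s w <> Z 0 w]]] t%:E).
  rewrite -/(return_time U Z w) ret leye_eq => /(_ _)/wrap[]//.
  exists t => //; split; [exact: lt_trans st|by rewrite Zt|].
  exists s; rewrite s0 st; split => //; rewrite Zs Z0 => /eqP.
  by rewrite -[X in _ == X]addr0 => /eqP /addrI.
move=> none; rewrite /return_time (_ : [set t | _] = set0) ?image_set0 ?ereal_inf0//.
rewrite -subset0 => t [t0 Ut [s [/andP[s0 st] Zs]]]; apply: none.
have [_ /(_ _ (ltW t0))[n [/andP[nt tn] Zt]]] := pathZ w.
have [_ /(_ _ (ltW s0))[m [/andP[ms sm] Zs']]] := pathZ w.
exists m => //; exists n => /=.
  rewrite leqNgt; apply/negP => nm.
  by have := lt_trans (le_lt_trans (le_trans (Smono w _ _ nm) ms) st) tn; rewrite ltxx.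
split; last by rewrite -Zt.
by move=> D0; apply: Zs; rewrite Zs' Z0 -/(disp m w) D0 addr0.
Qed.

Lemma measurable_no_return (U : {fset site d}) :
  measurable [set w | return_time U Z w = +oo%E].
Proof.
rewrite return_timeE; apply: measurableC; apply: bigcup_measurable => m _.
apply: bigcup_measurable => n _.
rewrite (_ : [set w | _] = ~` [set w | disp m w = 0] `&`
   \bigcup_(u in [set` U]) [set w | disp n w = u - y]).
  apply: measurableI; first by apply: measurableC; exact: measurable_displacement.
  apply: fin_bigcup_measurable; first exact: finite_fset.
  by move=> u _; exact: measurable_displacement.
apply/seteqP; split => w /=.
  by move=> [D U']; split => //; exists (y + disp n w) => //=; rewrite addrC addKr.
by move=> [D [u uU /= ->]]; split => //; rewrite addrC subrK.
Qed.

(** The first jump from an interior point of U already ends in U. *)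
Lemma no_return_interior (U : {fset site d}) : 0 \notin Gam ->
  (forall g, g \in Gam -> y + g \in U) ->
  [set w | return_time U Z w = +oo%E] = set0.
Proof.
move=> G0 yU; rewrite return_timeE -subset0 => w /=; apply.
have D1 : disp 1 w = val (J 0%N w) by rewrite /disp big_ord1.
exists 1%N => //; exists 1%N => //=; rewrite D1; split; last exact: yU (fsvalP _).
by move=> J0; move: G0; rewrite -J0 (fsvalP _).
Qed.

End Walk.

Lemma no_return_prob_bounds (U : {fset site d}) y : 0 <= no_return_prob R Gam U y <= 1.
Proof.
rewrite /no_return_prob; case: xgetP => [r _|_]; last by rewrite lexx ler01.
move=> [d' [T [P [Z [[J [W [_ mJ _ pathZ]]] ->]]]]].
have mE := measurable_no_return (fun k g => (mJ k g).1) pathZ U.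
by rewrite fine_ge0//= -lee_fin fineK ?fin_num_measure// probability_le1.
Qed.

Hypothesis adm : admissible_steps Gam.

Lemma no_return_prob_interior (U : {fset site d}) y : y \in U ->
  ~ inner_boundary Gam [set` U] y -> no_return_prob R Gam U y = 0.
Proof.
move=> yU yint; have [G0 Gsym _] := adm.
rewrite /no_return_prob; case: xgetP => [r _|//].
move=> [d' [T [P [Z [[J [W [_ mJ _ pathZ]]] ->]]]]].
rewrite (no_return_interior pathZ G0) ?measure0// => g gG.
apply/negPn/negP => ygU; apply: yint; split; first by move=> /(_ yU).
exists (y + g); first exact/negP.
by rewrite /adj opprD addNKr -Gsym.
Qed.

(** Interior points do not contribute, the others contribute a probability. *)
Lemma capacity_bounds (U : {fset site d}) :
  0 <= capacity R Gam U <= (card_inner_boundary Gam U)%:R.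
Proof.
have eq01 y : 0 <= equilibrium R Gam U y.
  by rewrite mulr_ge0//; have /andP[] := no_return_prob_bounds U y.
apply/andP; split; first by apply: sumr_ge0.
pose B := fset_set (inner_boundary Gam [set` U]).
have BsubU : inner_boundary Gam [set` U] `<=` [set` U] by move=> y [/contrapT].
have finB : finite_set (inner_boundary Gam [set` U]).
  by apply: sub_finite_set BsubU _; exact: finite_fset.
have BU y : y \in B = `[< inner_boundary Gam [set` U] y >].
  by rewrite in_fset_set//; apply/idP/asboolP; rewrite inE.
apply: (@le_trans _ _ (\sum_(y <- U) (y \in B)%:R)).
  rewrite /capacity big_seq [leRHS]big_seq; apply: ler_sum => y yU.
  rewrite /equilibrium yU mulr1 BU; case: asboolP => [_|yint].
    by have /andP[] := no_return_prob_bounds U y.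
  by rewrite no_return_prob_interior.
rewrite -(@big_fset_incl _ _ _ _ B U); last 2 first.
- by apply/fsubsetP => y; rewrite BU => /asboolP/BsubU.
- by move=> y _ /negbTE ->.
rewrite big_seq (eq_bigr (fun=> 1)); last by move=> y ->.
by rewrite -big_seq big_const_seq count_predT iter_addr_0.
Qed.

(** If sigma* = 0, the quotient is 0 by the convention a/0 = 0. *)
Lemma capacity_ratio (S S' : {fset site d}) :
  0 <= capacity R Gam S' / (sigma_star R Gam S S' ^+ 2 * (card_inner_boundary Gam S')%:R) <= 1.
Proof.
have /andP[c0 c1] := capacity_bounds S'.
set n : R := (card_inner_boundary _ _)%:R in c1 *; have n0 : 0 <= n by [].
case: (sigma_star_cases R Gam S S') => [->|s1].
  by rewrite expr0n mul0r invr0 mulr0 lexx ler01.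
have s2 : 1 <= sigma_star R Gam S S' ^+ 2 by rewrite expr_ge1// (le_trans _ s1).
have sp := lt_le_trans ltr01 s2.
apply/andP; split; first by rewrite divr_ge0// mulr_ge0// ltW.
have [->|nn0] := eqVneq n 0; first by rewrite mulr0 invr0 mulr0 ler01.
have np : 0 < n by rewrite lt_neqAle eq_sym nn0.
rewrite ler_pdivrMr; last exact: mulr_gt0.
by rewrite mul1r (le_trans c1)// ler_peMl.
Qed.

End Capacity.

(** * The lower limit *)

Section Liminf.
Variable R : realType.
Local Open Scope ereal_scope.

Lemma limn_esupE (u : nat -> \bar R) : limn_esup u = ereal_inf (range (esups u)).
Proof.
rewrite limn_esup_lim; apply/cvg_lim => //.
exact: (ereal_nonincreasing_cvgn (@nonincreasing_esups _ u)).
Qed.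

Lemma limn_einfE (u : nat -> \bar R) : limn_einf u = ereal_sup (range (einfs u)).
Proof.
rewrite limn_einf_lim; apply/cvg_lim => //.
exact: (ereal_nondecreasing_cvgn (@nondecreasing_einfs _ u)).
Qed.

Lemma limn_einf_le_frequently (a M : nat -> \bar R) (F : \bar R) (t : \bar R) :
  t < limn_esup M -> (forall n, t < M n -> a n <= F) -> limn_einf a <= F.
Proof.
move=> tM aF; rewrite limn_einfE; apply: ge_ereal_sup => _ [n _ <-].
have : t < esups M n.
  by apply: (lt_le_trans tM); rewrite limn_esupE; apply: ereal_inf_lbound; exists n.
move=> /ereal_sup_gt[_ [m /= nm <-] tm].
by apply: le_trans (aF _ tm); apply: ereal_inf_lbound; exists m.
Qed.

(** For t < M_infty, infinitely many n have M n > t, so the lower limit is at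
    most A e^{-c t^2}.  Taking t = M_infty/2, which costs the factor 1/4 in the
    exponent, avoids a limit t -> M_infty; if M_infty is infinite, t is taken
    large. *)
Lemma limn_einf_gaussian (a : nat -> \bar R) (M : nat -> R) (A c K : R) :
  (0 < A)%R -> (0 < c)%R -> (0 <= K <= 1)%R -> (forall n, 0 < M n)%R ->
  (forall n, a n <= (A * expR (- (c * M n ^+ 2)))%:E) ->
  limn_einf a <= A%:E * expeR (- ((c / 4)%:E *
     (K%:E * limn_esup (fun n => (M n)%:E)) ^+ 2)).
Proof.
move=> A0 c0 /andP[K0 K1] M0 aM.
set Minf := limn_esup _.
have Minf0 : 0 <= Minf.
  rewrite /Minf limn_esupE; apply: le_ereal_inf_tmp => _ [n _ <-].
  apply: (@le_trans _ _ (M n)%:E); first by rewrite lee_fin ltW.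
  by apply: ereal_sup_ubound; exists n => /=.
have below t : (0 <= t)%R -> t%:E < Minf ->
    limn_einf a <= (A * expR (- (c * t ^+ 2)))%:E.
  move=> t0 tM; apply: (limn_einf_le_frequently tM) => n tn.
  apply: (le_trans (aM n)); rewrite lee_fin ler_wpM2l ?(ltW A0)// ler_expR lerN2.
  by rewrite ler_wpM2l ?(ltW c0)// ler_pXn2r ?nnegrE ?(ltW (M0 n))// ltW// -lte_fin.
have trivial : limn_einf a <= A%:E.
  rewrite limn_einfE; apply: ge_ereal_sup => _ [n _ <-].
  apply: (@le_trans _ _ (a n)); first by apply: ereal_inf_lbound; exists n => /=.
  apply: (le_trans (aM n)); rewrite lee_fin ler_piMr ?(ltW A0)//.
  by rewrite -expR0 ler_expR oppr_le0 mulr_ge0 ?sqr_ge0 ?ltW.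
have [->|Kn0] := eqVneq K 0%R.
  by rewrite mul0e expe2 mul0e mule0 oppe0 expeR0 mule1.
have Kp : (0 < K)%R by rewrite lt_neqAle eq_sym Kn0.
clearbody Minf; case: Minf Minf0 below => [r| |]// r0 below.
  rewrite lee_fin in r0.
  rewrite expe2 -!EFinM /= -?EFinM.
  have [rz|rn0] := eqVneq r 0%R.
    by rewrite rz !mulr0 oppr0 expR0 mulr1.
  have rp : (0 < r)%R by rewrite lt_neqAle eq_sym rn0.
  have r2 : (0 <= r / 2)%R by rewrite divr_ge0.
  have /(below _ r2)/le_trans : (r / 2)%:E < r%:E by rewrite lte_fin; lra.
  apply; rewrite lee_fin ler_wpM2l ?(ltW A0)// ler_expR lerN2.
  have -> : (c * (r / 2) ^+ 2 = c / 4 * (r * r))%R by field.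
  rewrite ler_wpM2l ?divr_ge0 ?(ltW c0)//.
  have Kr : (K * r <= r)%R by rewrite ler_piMl.
  have Kr0 : (0 <= K * r)%R by rewrite mulr_ge0.
  by apply: ler_pM.
rewrite gt0_muley ?lte_fin// expe2 mulyy gt0_muley ?lte_fin ?divr_gt0//= mule0.
apply/lee_addgt0Pr => e e0; rewrite add0e.
(* With this t, A e^{-c t^2} = A e^{-A/e} <= e because e^x >= x. *)
pose t := Num.sqrt (A / (c * e)).
have t2 : (t ^+ 2 = A / (c * e))%R by rewrite sqr_sqrtr// divr_ge0 ?mulr_ge0 ?ltW.
apply: (le_trans (below t (sqrtr_ge0 _) (ltry _))); rewrite lee_fin t2.
have -> : (c * (A / (c * e)) = A / e)%R by field; rewrite !gt_eqF.
rewrite expRN ler_pdivrMr ?expR_gt0//.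
have Ae : (A = e * (A / e))%R by field; rewrite gt_eqF.
rewrite [leLHS]Ae ler_wpM2l ?(ltW e0)// (le_trans _ (expR_ge1Dx _))//.
by rewrite lerDr.
Qed.

End Liminf.

Theorem lemma3p4 (R : realType) (d : nat) (Gam : {fset site d}) (c0 : R) :
  (3 <= d)%N -> admissible_steps Gam -> 1 <= c0 ->
  exists c1 c2 : R, [/\ 0 < c1, 0 < c2 &
    forall (alpha : R) (V : potential Gam c0 alpha)
      (S S' : {fset site d}) (eps : R)
      (Lam : nat -> {fset site d}) (M : nat -> R),
    0 < alpha ->
    S != fset0 -> S' != fset0 -> [disjoint S & S']%fset -> 0 < eps ->
    (forall n, (Lam n `<=` Lam n.+1)%fset) ->
    (forall x, exists n, x \in Lam n) ->
    (forall n, 0 < M n) ->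
    let Minf := limn_esup (fun n => (M n)%:E) in
    let nb := card_inner_boundary Gam S' in
    (limn_einf (fun n => gibbs_pair V (Lam n) (bad_event V S S' eps (Lam n) (M n)))
     <= (c1 * #|` S|%:R * 2 ^+ nb)%:E *
        expeR (- (c2%:E *
          ((capacity R Gam S' / (sigma_star R Gam S S' ^+ 2 * nb%:R))%:E * Minf)
          ^+ 2)))%E].
Proof.
move=> d3 adm c0_ge1; have c0_gt0 : 0 < c0 by rewrite (lt_le_trans ltr01).
have [kap kap_gt0 convexH] := hamiltonian_convex d3 adm c0_gt0.
exists 2, (kap / 2 / 4); split; [by []|by rewrite !divr_gt0|].
move=> alpha V S S' eps Lam M _ S0 _ _ _ _ _ M0; cbv zeta.
set nb := card_inner_boundary _ _.
have S1 : 1 <= #|` S|%:R :> R by rewrite ler1n cardfs_gt0.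
apply: limn_einf_gaussian => //.
- by rewrite !mulr_gt0 ?exprn_gt0// (lt_le_trans ltr01).
- by rewrite divr_gt0.
- exact: capacity_ratio.
move=> n; apply: (@le_trans _ _ (2 * nb%:R * expR (- (kap / 2 * M n ^+ 2)))%:E).
  have sub := @bad_event_sub R d Gam c0 alpha V S S' eps (Lam n) (M n) (ltW (M0 n)).
  apply: le_trans (gibbs_pair_mono V (Lam n) sub) _.
  exact: (gibbs_pair_tail kap_gt0 (convexH _ V (Lam n)) _ (ltW (M0 n))).
rewrite lee_fin ler_wpM2r ?expR_ge0// -mulrA ler_wpM2l//.
apply: (@le_trans _ _ (2 ^+ nb)); first by rewrite -natrX ler_nat ltnW// ltn_expl.
by rewrite ler_peMl// exprn_ge0.
Qed.
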